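(* Let $X,Y$ be second order stochastic processes. Let $\alpha>0$, $p,q\geq1$, and $\frac1p+\frac1q\leq1+\alpha$ (with $p\neq1$ and $q\neq1$ in the case where $\frac1p+\frac1q=1+\alpha$). (i) If $t\mapsto E(X_t)$ is in $L_p(a,b)$ and $t\mapsto E(Y_t)$ is in $L_q(a,b)$, then $$E\left(\int_a^b X_t\;{_a^s}I_t^{\alpha}Y_t\,dt\right)=E\left(\int_a^b Y_t\;{_t^s}I_b^{\alpha}X_t\,dt\right).$$ (ii) If $t\mapsto E(X_t)$ is in ${_t}I_b^{\alpha}(L_p)$ and $t\mapsto E(Y_t)$ is in ${_a}I_t^{\alpha}(L_q)$, then $$E\left(\int_a^b X_t\,\left({_a^s}D_t^{\alpha}Y_t\right)dt\right)=E\left(\int_a^b Y_t\,\left({_t^s}D_b^{\alpha}X_t\right)dt\right).$$ (iii) For the stochastic Caputo fractional derivatives, with $\alpha\in(0,1)$, one has $$E\left[\int_a^b X_t\left({_a^{sC}}D_t^{\alpha}Y_t\right)dt\right]=E\left[\int_a^b Y_t\left({_t^s}D_b^{\alpha}X_t\right)dt\right]+E\left[\left({_t^s}I_b^{1-\alpha}X_t\right)\cdot Y_t\right]_a^b$$ and $$E\left[\int_a^b X_t\left({_t^{sC}}D_b^{\alpha}Y_t\right)dt\right]=E\left[\int_a^b Y_t\left({_a^s}D_t^{\alpha}X_t\right)dt\right]-E\left[\left({_a^s}I_t^{1-\alpha}X_t\right)\cdot Y_t\right]_a^b.$$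
   Context: $(\Omega,F,P)$ is a probability space, $E$ is the expectation, and $H=L_2(\Omega,P)$. $I$ is an open time interval and $[a,b]\subset I$. A second order stochastic process is a mapping $X:I\to H$, $t\mapsto X(t)=X_t$. For $\alpha>0$ and $n=[\alpha]+1$, the stochastic fractional operators are the deterministic functions obtained by applying the classical operators to $t\mapsto E(X_t)$. They are introduced for processes with $E(X(t))\in AC^n([a,b]\to\mathbb{R})$ ($AC$ meaning absolutely continuous), and in (i) and (ii) the same formulas are used under the hypotheses stated there: - left/right Riemann--Liouville integrals: ${_a^s}I_t^{\alpha}X(t)={_a}I_t^{\alpha}[E(X_t)]=\frac{1}{\Gamma(\alpha)}\int_a^t(t-\tau)^{\alpha-1}E(X_\tau)\,d\tau$ ($t>a$) and ${_t^s}I_b^{\alpha}X(t)={_t}I_b^{\alpha}[E(X_t)]=\frac{1}{\Gamma(\alpha)}\int_t^b(\tau-t)^{\alpha-1}E(X_\tau)\,d\tau$ ($t<b$); - left/right Riemann--Liouville derivatives: ${_a^s}D_t^{\alpha}X(t)={_a}D_t^{\alpha}[E(X_t)]=\frac{1}{\Gamma(n-\alpha)}\left(\frac{d}{dt}\right)^n\int_a^t(t-\tau)^{n-1-\alpha}E(X_\tau)\,d\tau$ ($t>a$) and ${_t^s}D_b^{\alpha}X(t)={_t}D_b^{\alpha}[E(X_t)]=\frac{1}{\Gamma(n-\alpha)}\left(-\frac{d}{dt}\right)^n\int_t^b(\tau-t)^{n-1-\alpha}E(X_\tau)\,d\tau$ ($t<b$); - left/right Caputo derivatives: ${_a^{sC}}D_t^{\alpha}X(t)={_a^C}D_t^{\alpha}[E(X_t)]=\frac{1}{\Gamma(n-\alpha)}\int_a^t(t-\tau)^{n-1-\alpha}E(X(\tau))^{(n)}\,d\tau$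 ($t>a$) and ${_t^{sC}}D_b^{\alpha}X(t)={_t^C}D_b^{\alpha}[E(X_t)]=\frac{(-1)^n}{\Gamma(n-\alpha)}\int_t^b(\tau-t)^{n-1-\alpha}E(X(\tau))^{(n)}\,d\tau$ ($t<b$). ${_a}I_t^{\alpha}(L_q)$ and ${_t}I_b^{\alpha}(L_p)$ denote the images of $L_q(a,b)$ and $L_p(a,b)$ under the classical left and right Riemann--Liouville fractional integral operators of order $\alpha$. The notation $E[Z_t]_a^b$ means $E[Z_b]-E[Z_a]$.
   Formalization: The random integrals are taken as pathwise Lebesgue integrals, and each integrand in a formula is assumed jointly measurable and absolutely integrable over Ω×(a,b); without this the integrals may not exist or the two sides may differ. In (iii) both E(X_t) and E(Y_t) are absolutely continuous on [a,b]. *)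

(* Defs.v *)
From HB Require Import structures.
From mathcomp Require Import all_boot all_order all_algebra.
From mathcomp Require Import all_classical all_reals all_analysis.
Set Implicit Arguments.
Unset Strict Implicit.
Unset Printing Implicit Defensive.
Import Order.TTheory GRing.Theory Num.Theory.
Import numFieldNormedType.Exports.
Local Open Scope classical_set_scope.
Local Open Scope ring_scope.

(* Convention: every integral between two end points is a Lebesgue integral over
   the open interval; closing it would not change the value. In particular an
   operator with base point a takes the value 0 at a. *)

Section classical_operators.
Context {R : realType}.
Local Notation mu := (@lebesgue_measure R).
Implicit Types (alpha s a b t : R) (f : R -> R) (n : nat).

Definition Gamma s : R :=
  \int[mu]_(x in `]0, +oo[) (x `^ (s - 1) * expR (- x)).

(* n = [alpha] + 1; truncn is the floor on nonnegative reals *)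
Definition frac_order alpha : nat := (Num.truncn alpha).+1.

Definition RLint_left alpha a f t : R :=
  (Gamma alpha)^-1 * \int[mu]_(tau in `]a, t[) ((t - tau) `^ (alpha - 1) * f tau).

Definition RLint_right alpha b f t : R :=
  (Gamma alpha)^-1 * \int[mu]_(tau in `]t, b[) ((tau - t) `^ (alpha - 1) * f tau).

Definition RLder_left alpha a f t : R :=
  let n := frac_order alpha in
  (Gamma (n%:R - alpha))^-1 *
  derive1n n (fun s =>
    \int[mu]_(tau in `]a, s[) ((s - tau) `^ (n%:R - 1 - alpha) * f tau)) t.

Definition RLder_right alpha b f t : R :=
  let n := frac_order alpha in
  (Gamma (n%:R - alpha))^-1 * ((-1) ^+ n *
  derive1n n (fun s =>
    \int[mu]_(tau in `]s, b[) ((tau - s) `^ (n%:R - 1 - alpha) * f tau)) t).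

Definition Cder_left alpha a f t : R :=
  let n := frac_order alpha in
  (Gamma (n%:R - alpha))^-1 *
  \int[mu]_(tau in `]a, t[) ((t - tau) `^ (n%:R - 1 - alpha) * derive1n n f tau).

Definition Cder_right alpha b f t : R :=
  let n := frac_order alpha in
  ((-1) ^+ n / Gamma (n%:R - alpha)) *
  \int[mu]_(tau in `]t, b[) ((tau - t) `^ (n%:R - 1 - alpha) * derive1n n f tau).

(* Only the values of f on ]a, b[ matter: the restriction is extended by 0. *)
Definition in_Lp (p a b : R) f : Prop := f \_ `]a, b[ \in Lfun mu p%:E.

(* The images of L_p(a, b) consist of classes of functions, hence the equality
   almost everywhere. *)
Definition in_RLint_left alpha (q a b : R) f : Prop :=
  exists2 g, in_Lp q a b g & f = RLint_left alpha a g %[ae mu in `]a, b[%classic].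

Definition in_RLint_right alpha (p a b : R) f : Prop :=
  exists2 g, in_Lp p a b g & f = RLint_right alpha b g %[ae mu in `]a, b[%classic].

Definition abs_continuous a b f : Prop :=
  forall e : R, 0 < e -> exists2 d : R, 0 < d &
    forall (n : nat) (u v : 'I_n -> R),
      (forall i, a <= u i /\ u i <= v i /\ v i <= b) ->
      trivIset [set: 'I_n] (fun i => `]u i, v i[%classic) ->
      \sum_(i < n) (v i - u i) < d ->
      \sum_(i < n) `|f (v i) - f (u i)| < e.

End classical_operators.

Section stochastic_operators.
Context {d : measure_display} {T : measurableType d} {R : realType}.
Variable P : probability T R.
Local Notation mu := (@lebesgue_measure R).
Implicit Types (X Z : R -> T -> R) (alpha a b t : R).

Definition second_order (I : set R) X : Prop :=
  forall t, I t -> X t \in Lfun P 2%:E.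

(* For a second order process the expectation is finite on I. *)
Definition mean X t : R := fine 'E_P[X t].

Definition sRLint_left alpha a X := RLint_left alpha a (mean X).
Definition sRLint_right alpha b X := RLint_right alpha b (mean X).
Definition sRLder_left alpha a X := RLder_left alpha a (mean X).
Definition sRLder_right alpha b X := RLder_right alpha b (mean X).
Definition sCder_left alpha a X := Cder_left alpha a (mean X).
Definition sCder_right alpha b X := Cder_right alpha b (mean X).

(* The random variable \int_a^b Z_t dt is taken path by path. *)
Definition path_int a b Z (w : T) : R := \int[mu]_(t in `]a, b[) Z t w.

Definition Eint a b Z : \bar R := 'E_P[path_int a b Z]%E.

(* Joint measurability of Z together with E (\int_a^b |Z_t| dt) < +oo; this is
   what makes [Eint a b Z] meaningful. *)
Definition path_integrable a b Z : Prop :=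
  (P \x mu)%E.-integrable ([set: T] `*` `]a, b[) (fun z => (Z z.2 z.1)%:E).

Definition Ebracket a b Z : \bar R := ('E_P[Z b] - 'E_P[Z a])%E.

End stochastic_operators.

(* Main.v *)
Require Import Defs.
From HB Require Import structures.
From mathcomp Require Import all_boot all_order all_algebra.
From mathcomp Require Import all_classical all_reals all_analysis.
From mathcomp Require Import measurable_realfun ring lra.

(** The stochastic operators of X are deterministic functions of t. So if phi is
    one of them, Fubini turns the expectation of the path integral of X_t phi(t)
    into the integral of E(X_t) phi(t) ([Eint_mean]), the expectations at the end
    points split off a constant factor ([Ebracket_mean]), and the theorem becomes
    a statement about the two real functions f = E(X) and g = E(Y).

    (i) Up to 1 / Gamma alpha, both sides are the double integral over u < t of
    f(t) (t - u)^(alpha - 1) g(u), in the two orders of integration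
    ([Fubini_adjoint]). The order can be exchanged once the double integral of
    the absolute value is finite, which is the Hardy-Littlewood-Sobolev inequality
    in the critical case 1/p + 1/q = 1 + alpha with p, q > 1. It has a direct
    proof: with F = |f|^p and G = |g|^q, put x = 1/p and y = 1/q and compare the
    two values. Where G(u) <= F(t), rescaling the distance s = t - u by F(t) gives
    the pointwise bound
        F^x s^(alpha - 1) G^y <= F G + F^2 k(F s)
    with k integrable ([hls_pointwise]), and the last term integrates in u to a
    multiple of F(t); where F(t) <= G(u) the roles are exchanged
    ([energy_critical]). Below the critical line both exponents can be raised,
    because the interval has finite length; the cases where one exponent is 1 or
    alpha >= 1 are easier ([energy_Lp]).

    (ii) If f is the right integral of phi and g is the left integral of psi, then
    the derivatives of f and g are phi and psi almost everywhere, and the claim is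
    (i) for phi and psi. That the derivative inverts the integral follows from
    the semigroup law of fractional integrals, that is, from the Beta integral
    ([fracint_semigroup]): before differentiation one has the n-fold primitive of
    psi ([RLder_left_RLint_left]). All right-hand operators are left-hand ones
    after the reflection t -> - t, so only the latter are studied.

    (iii) Absolutely continuous functions are primitives of integrable functions
    ([abs_continuous_primitive]). Let f' and g' be the densities of f and g. By the
    semigroup law, f is the left fractional integral of order alpha of
        rho(t) = f(a) (t - a)^(- alpha) / Gamma(1 - alpha) + I^(1 - alpha) f'(t),
    so rho is the fractional derivative of f, and I^(1 - alpha) f is the ordinary
    primitive of rho ([primitive_fractional]). Two applications of Fubini move
    I^(1 - alpha), and then the primitive, from one factor to the other: the
    integral of f times the right Caputo derivative of g is the integral of
    rho(u) (g(u) - g(b)), and the integral of rho is I^(1 - alpha) f at b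
    ([Caputo_right_by_parts]). The other identity is its reflection. *)

Set Implicit Arguments.
Unset Strict Implicit.
Unset Printing Implicit Defensive.
Import Order.TTheory GRing.Theory Num.Theory.
Import numFieldNormedType.Exports.
Local Open Scope classical_set_scope.
Local Open Scope ring_scope.

(** * Changes of variable and modification on null sets *)

Section change_of_variable.
Context {R : realType}.
Local Notation mu := (@lebesgue_measure R).
Local Open Scope ereal_scope.

Let affine (c d : R) : measurableTypeR R -> measurableTypeR R :=
  fun x => (c * x + d)%R.

Let measurable_affine c d : measurable_fun setT (affine c d).
Proof. by apply: measurable_funD => //; exact: measurable_funM. Qed.

Let affine_image c d : {measure set (measurableTypeR R) -> \bar R} :=
  measure_function_pushforward__canonical__measure_function_Measure
    mu (measurable_affine c d).

(** Both sides agree on half-open intervals, hence on all Borel sets. *)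
Lemma lebesgue_measure_affine (c : {nonneg R}) (d : R) (A : set R) :
  (0 < c%:num)%R -> measurable A ->
  mscale c (affine_image c%:num d) A = mu A.
Proof.
move=> c0 mA; apply/esym/lebesgue_measure_unique => //= _ [[a b]] _ <-.
rewrite /mscale/= /pushforward /affine.
rewrite (_ : _ @^-1` _ = `]((a - d) / c%:num)%R, ((b - d) / c%:num)%R]%classic); last first.
  apply/seteqP; split=> x /=; rewrite !in_itv/= ltr_pdivrMr// ler_pdivlMr//;
    by rewrite ltrBlDr lerBrDr mulrC.
rewrite !lebesgue_measure_itv/= !lte_fin ltr_pM2r ?invr_gt0// ltrD2r.
case: ifPn => _; last by rewrite mule0.
by rewrite -!EFinD -EFinM; congr EFin; field; rewrite gt_eqF.
Qed.

Lemma ge0_integral_affine (c d : R) (f : R -> \bar R) : (0 < c)%R ->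
  measurable_fun setT f -> (forall x, 0 <= f x) ->
  \int[mu]_x f x = c%:E * \int[mu]_x f (c * x + d)%R.
Proof.
move=> c0 mf f0; pose c' := NngNum (ltW c0).
have := @ge0_integral_pushforward _ _ _ _ R _ (measurable_affine c d) mu setT f
  measurableT mf (fun x _ => f0 x).
rewrite preimage_setT /= => <-.
have := @ge0_integral_mscale _ _ R (affine_image c d) setT measurableT c' f mf
  (fun x _ => f0 x).
move=> /= <-; apply: eq_measure_integral => A mA _.
by rewrite -[LHS](@lebesgue_measure_affine c' d).
Qed.

Lemma ge0_integral_shift (d : R) (f : R -> \bar R) :
  measurable_fun setT f -> (forall x, 0 <= f x) ->
  \int[mu]_x f (x + d)%R = \int[mu]_x f x.
Proof.
move=> mf f0; rewrite [RHS](@ge0_integral_affine 1 d)// mul1e.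
by under [RHS]eq_integral do rewrite mul1r.
Qed.

Lemma ge0_integral_opp (f : R -> \bar R) :
  measurable_fun setT f -> (forall x, 0 <= f x) ->
  \int[mu]_x f (- x)%R = \int[mu]_x f x.
Proof.
move=> mf f0.
have mphi : measurable_fun setT
    ((fun x => - x)%R : measurableTypeR R -> measurableTypeR R).
  exact: measurable_funN.
have := @ge0_integral_pushforward _ _ _ _ R _ mphi mu setT f measurableT mf (fun x _ => f0 x).
rewrite preimage_setT => <-.
apply: eq_measure_integral => A mA _.
by have := lebesgue_measureN mA.
Qed.

Lemma ge0_integral_reflect (d : R) (f : R -> \bar R) :
  measurable_fun setT f -> (forall x, 0 <= f x) ->
  \int[mu]_x f (d - x)%R = \int[mu]_x f x.
Proof.
move=> mf f0; rewrite -[RHS](ge0_integral_shift d)//.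
rewrite -[RHS]ge0_integral_opp//.
- by under eq_integral do rewrite addrC.
- apply: (measurableT_comp mf) => //; exact: measurable_funD.
Qed.

End change_of_variable.

Section ae_equality.
Context d (T : measurableType d) (R : realType).
Variable mu : {measure set T -> \bar R}.
Local Open Scope ereal_scope.
Import HBNNSimple.

(** The integral of a nonnegative function is the supremum of the integrals of
    the simple functions below it, and these can be cut off on a null set: so
    one of the two functions need not be measurable. *)
Lemma ge0_ae_eq_integralT (f g : T -> \bar R) : measurable_fun setT g ->
  (forall x, 0 <= f x) -> (forall x, 0 <= g x) ->
  {ae mu, forall x, f x = g x} -> \int[mu]_x f x = \int[mu]_x g x.
Proof.
move=> mg f0 g0 [N [mN N0 fgN]].
have fgE x : ~ N x -> f x = g x.
  by move=> Nx; apply/not_notP => h; apply: Nx; exact: fgN.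
have mNC := measurableC mN.
have cut (h : T -> \bar R) : measurable_fun setT h -> (forall x, 0 <= h x) ->
    \int[mu]_x h x = \int[mu]_x (h \_ (~` N)) x.
  move=> mh h0; rewrite -integral_mkcond.
  by rewrite (@ge0_negligible_integral _ _ _ mu setT N)// setTD.
apply/eqP; rewrite eq_le; apply/andP; split; last first.
  rewrite cut//.
  apply: (@le_trans _ _ (\int[mu]_x (f \_ (~` N)) x)).
    rewrite le_eqVlt; apply/orP; left; apply/eqP; apply: eq_integral => x _.
    rewrite /patch; case: ifPn => //; rewrite inE => Nx.
    by rewrite fgE.
  rewrite !ge0_integralTE//; last by move=> x; rewrite /patch; case: ifP.
  apply: le_ereal_sup => _ [h /= hf <-]; exists h => //= x.
  by rewrite (le_trans (hf x))// /patch; case: ifP.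
rewrite [leLHS]ge0_integralTE//; apply: ge_ereal_sup => _ [h /= hf <-].
have -> : sintegral mu h = \int[mu]_x (EFin \o h) x 
  by rewrite /comp integral_nnsfun// patch_setT.
rewrite cut//; last 2 first.
  by apply/measurable_EFinP.
  by move=> x; rewrite /= lee_fin.
rewrite [leRHS]cut//; apply: ge0_le_integral => //.
- by move=> x _; apply: erestrict_ge0 => y _; rewrite /= lee_fin.
- by apply/(measurable_restrictT _ mNC)/measurable_funTS/measurable_EFinP.
- by apply/(measurable_restrictT _ mNC)/measurable_funTS.
- move=> x _; rewrite /patch; case: ifPn => //; rewrite inE => Nx.
  by rewrite /= -(fgE x Nx); exact: hf.
Qed.

(** The mean of a process is only known to agree almost everywhere with a
    measurable function, whence the form of this lemma and of the next one. *)
Lemma ae_eq_integral_nomeas (D : set T) (f g : T -> \bar R) :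
  measurable D -> measurable_fun D g ->
  f = g %[ae mu in D] -> \int[mu]_(x in D) f x = \int[mu]_(x in D) g x.
Proof.
move=> mD mg fg; rewrite integral_mkcond [RHS]integral_mkcond.
have mgD : measurable_fun setT (g \_ D) by exact/(measurable_restrictT _ mD).
have fgD : {ae mu, forall x, (f \_ D) x = (g \_ D) x}.
  apply: filterS fg => x /= fgx; rewrite /patch; case: ifPn => //.
  by rewrite inE => /fgx.
rewrite integralE [RHS]integralE; congr (_ - _); apply: ge0_ae_eq_integralT => //.
- exact: measurable_funepos.
- by apply: filterS fgD => x fgx; rewrite !funeposE fgx.
- exact: measurable_funeneg.
- by apply: filterS fgD => x fgx; rewrite !funenegE fgx.
Qed.

Lemma ae_eq_Rintegral (D : set T) (f g : T -> R) :
  measurable D -> measurable_fun D g ->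
  f = g %[ae mu in D] ->
  (\int[mu]_(x in D) f x = \int[mu]_(x in D) g x)%R.
Proof.
move=> mD mg fg; congr fine; apply: ae_eq_integral_nomeas => //.
  exact/measurable_EFinP.
by apply: filterS fg => x fgx Dx; rewrite fgx.
Qed.

End ae_equality.

Lemma ae_eq_integrable d (T : measurableType d) (R : realType)
    (mu : {measure set T -> \bar R}) (D : set T) (f g : T -> \bar R) :
  measurable D -> measurable_fun D g -> f = g %[ae mu in D] ->
  mu.-integrable D f -> mu.-integrable D g.
Proof.
move=> mD mg fg /integrableP[mf fi]; apply/integrableP; split => //.
rewrite -(@ae_eq_integral_nomeas _ _ _ mu D (abse \o f))//.
  exact: measurableT_comp.
by apply: filterS fg => x fgx Dx /=; rewrite fgx.
Qed.

Lemma integrable_restrictT {R : realType} (D : set R) (f : R -> R) : measurable D ->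
  (@lebesgue_measure R).-integrable D (EFin \o f) <->
  (@lebesgue_measure R).-integrable setT (EFin \o (f \_ D)).
Proof.
move=> mD; rewrite -restrict_EFin.
exact: (@integrable_mkcond _ (measurableTypeR R) R
  (@lebesgue_measure R : {measure set (measurableTypeR R) -> \bar R}) D (EFin \o f) mD).
Qed.

Lemma lebesgue_aeS {R : realType} (P Q : R -> Prop) : (forall x, P x -> Q x) ->
  {ae @lebesgue_measure R, forall x, P x} -> {ae @lebesgue_measure R, forall x, Q x}.
Proof. by move=> PQ; apply: filterS => //; exact: (ae_filter_ringOfSetsType lebesgue_measure). Qed.

Lemma lebesgue_aeI {R : realType} (P Q : R -> Prop) :
  {ae @lebesgue_measure R, forall x, P x} -> {ae @lebesgue_measure R, forall x, Q x} ->
  {ae @lebesgue_measure R, forall x, P x /\ Q x}.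
Proof. by move=> ? ?; apply: filterI => //; exact: (ae_filter_ringOfSetsType lebesgue_measure). Qed.

Lemma integrable_measurable {R : realType} (f : R -> R) :
  (@lebesgue_measure R).-integrable setT (EFin \o f) -> measurable_fun setT f.
Proof. by move=> fi; apply/measurable_EFinP; exact: measurable_int fi. Qed.

(** * The power kernel *)

Section bounded_integrals.
Context d (T : measurableType d) (R : realType).
Variable mu : {measure set T -> \bar R}.
Local Open Scope ereal_scope.

(** Monotone convergence: the way to bound the integral of a power on an unbounded
    interval, or on one that ends at 0. *)
Lemma ge0_integral_bigcup_le (F : (set T)^nat) (f : T -> \bar R) (M : \bar R) :
  nondecreasing_seq F -> (forall i, measurable (F i)) ->
  measurable_fun setT f -> (forall x, 0 <= f x) ->
  (forall i, \int[mu]_(x in F i) f x <= M) ->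
  \int[mu]_(x in \bigcup_i F i) f x <= M.
Proof.
move=> ndF mF mf f0 fM.
have cv := @ge0_nondecreasing_set_cvg_integral _ _ _ F f mu ndF mF
  (fun i => measurable_funTS mf) (fun i x _ => f0 x).
rewrite -(cvg_lim _ cv)//; apply: lime_le; first by apply/cvg_ex; eexists; exact: cv.
by near=> n; exact: fM.
Unshelve. all: end_near. Qed.

End bounded_integrals.

Section power_kernel.
Context {R : realType}.
Local Notation mu := (@lebesgue_measure R).

(** The convolution kernel of fractional integration, up to the factor
    [Gamma al]. Extending it by 0 to the negative half-line turns integrals with
    a variable end point into convolutions on the whole line. *)
Definition kpow (al s : R) : R := if 0 < s then s `^ (al - 1) else 0.

Lemma kpow_ge0 al s : 0 <= kpow al s.
Proof. by rewrite /kpow; case: ifP => // _; exact: powR_ge0. Qed.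

Lemma kpow_gt0 al s : 0 < s -> 0 < kpow al s.
Proof. by move=> s0; rewrite /kpow s0 powR_gt0. Qed.

Lemma kpow_le0 al s : s <= 0 -> kpow al s = 0.
Proof. by move=> s0; rewrite /kpow ltNge s0. Qed.

Lemma measurable_kpow al : measurable_fun setT (kpow al).
Proof.
by apply: measurable_fun_ifT => //; exact: measurable_fun_ltr.
Qed.

Lemma kpowM al c s : 0 < c -> kpow al (c * s) = c `^ (al - 1) * kpow al s.
Proof.
move=> c0; rewrite /kpow pmulr_rgt0//; case: ifP => s0; last by rewrite mulr0.
by rewrite powRM// ltW.
Qed.

Lemma integral_powR_itv (r x y : R) : r != 0 -> 0 < x -> x < y ->
  (\int[mu]_(s in `[x, y]) (s `^ (r - 1))%:E = ((y `^ r - x `^ r) / r)%:E)%E.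
Proof.
move=> r0 x0 xy.
have dF (s : R) : 0 < s -> is_derive s 1 (fun s => s `^ r / r) (s `^ (r - 1)).
  move=> s0.
  have -> : (fun s : R => s `^ r / r) = r^-1 \*: (@powR R ^~ r).
    by apply/funext => z /=; rewrite mulrC.
  have [h1 h2] : is_derive s 1 (@powR R ^~ r) (r * s `^ (r - 1)).
    exact: is_derive1_powR.
  split; first exact: derivableZ.
  by rewrite deriveZ// h2 -[LHS]/(r^-1 * (r * s `^ (r - 1))) mulrA mulVf// mul1r.
have cont (g : R -> R) : (forall s, 0 < s -> derivable g s 1) ->
    {within `[x, y], continuous g}.
  move=> dg; apply: derivable_within_continuous => s; rewrite in_itv/= => /andP[xs _].
  exact/dg/(lt_le_trans x0).
have dF' s : 0 < s -> derivable (fun s => s `^ r / r) s 1.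
  by move=> s0; have := dF s s0 => -[].
rewrite (@continuous_FTC2 _ (fun s => s `^ (r - 1)) (fun s => s `^ r / r))//.
- by rewrite -EFinB -mulrBl.
- by apply: cont => s s0; apply: derivable_powR; rewrite in_itv/= s0.
- have cF := @cont _ dF'.
  have /(continuous_within_itvP _ xy)[c1 c2 c3] := cF.
  split => // s; rewrite in_itv/= => /andP[xs _]; exact/dF'/(lt_trans x0).
- move=> s; rewrite in_itv/= => /andP[xs _]; rewrite derive1E.
  by have [_ ->] := dF s (lt_trans x0 xs).
Qed.

Lemma integral_powR_head (al c : R) : 0 < al -> 0 < c ->
  (\int[mu]_(s in `]0%R, c]) (s `^ (al - 1))%:E < +oo)%E.
Proof.
move=> al0 c0.
pose F n : set R := `[c / n.+2%:R, c]%classic.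
have -> : `]0, c]%classic = \bigcup_n F n.
  apply/seteqP; split => s /=; rewrite in_itv/=.
  - move=> /andP[s0 sc]; exists (Num.truncn (c / s)); rewrite // /F/= in_itv/= sc andbT.
    rewrite ler_pdivrMr// mulrC -ler_pdivrMr//; apply/ltW/(lt_trans (truncnS_gt _)).
    by rewrite ltr_nat.
  - move=> [n _]; rewrite /F/= in_itv/= => /andP[s1 ->]; rewrite andbT.
    by rewrite (lt_le_trans _ s1)// divr_gt0.
apply: (@le_lt_trans _ _ (c `^ al / al)%:E); last by rewrite ltry.
apply: ge0_integral_bigcup_le.
- move=> m n mn; apply/subsetPset => s; rewrite /F/= !in_itv/= => /andP[s1 ->].
  rewrite andbT (le_trans _ s1)// ler_wpM2l ?(ltW c0)// lef_pV2 ?posrE//.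
  by rewrite ler_nat !ltnS.
- by move=> i; exact: measurable_itv.
- by apply/measurable_EFinP; exact: measurable_powR.
- by move=> s; rewrite lee_fin powR_ge0.
- move=> n; rewrite /F integral_powR_itv ?gt_eqF//.
  + rewrite lee_fin ler_wpM2r ?invr_ge0 ?(ltW al0)//.
    by rewrite gerBl powR_ge0.
  + by rewrite divr_gt0.
  + by rewrite ltr_pdivrMr// ltr_pMr// ltr1n.
Qed.

Lemma integral_powR_tail (r : R) : 0 < r ->
  (\int[mu]_(s in `[1%R, +oo[) (s `^ (- r - 1))%:E < +oo)%E.
Proof.
move=> r0.
pose F n : set R := `[1, n.+2%:R]%classic.
have -> : `[1, +oo[%classic = \bigcup_n F n.
  apply/seteqP; split => s /=; rewrite in_itv/= ?andbT.
  - move=> s1; exists (Num.truncn s); rewrite // /F/= in_itv/= s1.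
    by apply/ltW/(lt_trans (truncnS_gt _)); rewrite ltr_nat.
  - by move=> [n _]; rewrite /F/= in_itv/= => /andP[s1 _].
apply: (@le_lt_trans _ _ (r^-1)%:E); last by rewrite ltry.
apply: ge0_integral_bigcup_le.
- move=> m n mn; apply/subsetPset => s; rewrite /F/= !in_itv/= => /andP[-> s1]/=.
  by rewrite (le_trans s1)// ler_nat !ltnS.
- by move=> i; exact: measurable_itv.
- by apply/measurable_EFinP; exact: measurable_powR.
- by move=> s; rewrite lee_fin powR_ge0.
- move=> n; rewrite /F integral_powR_itv ?oppr_eq0 ?gt_eqF// ?ltr1n//.
  rewrite lee_fin powR1 invrN mulrN -mulNr opprB ler_pdivrMr// mulVf ?gt_eqF//.
Qed.

End power_kernel.

(** * The Gamma function and the Beta integral *)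

Section gamma_beta.
Context {R : realType}.
Local Notation mu := (@lebesgue_measure R).

Lemma restrictE {U : Type} (D : set U) (f : U -> R) x :
  (f \_ D) x = if x \in D then f x else 0.
Proof. by []. Qed.

Lemma erestrictE {U : Type} (D : set U) (f : U -> \bar R) x :
  (f \_ D) x = (if x \in D then f x else 0)%E.
Proof. by []. Qed.

Lemma measurable_kpowB al :
  measurable_fun setT (fun z : R * R => kpow al (z.1 - z.2)).
Proof.
apply: (measurableT_comp (@measurable_kpow R al)).
by apply: measurable_funB; [exact: measurable_fst|exact: measurable_snd].
Qed.

Lemma measurable_kpowBr al (s : R) : measurable_fun setT (fun u : R => kpow al (s - u)).
Proof. by apply: (measurableT_comp (@measurable_kpow R al)); exact: measurable_funB. Qed.

Lemma measurable_kpowBl al (s : R) : measurable_fun setT (fun u : R => kpow al (u - s)).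
Proof. by apply: (measurableT_comp (@measurable_kpow R al)); exact: measurable_funB. Qed.

Lemma lebesgue_tonelli (f : R * R -> \bar R) :
  measurable_fun setT f -> (forall z, 0 <= f z)%E ->
  (\int[mu]_x \int[mu]_y f (x, y) = \int[mu]_y \int[mu]_x f (x, y))%E.
Proof.
move=> mf f0.
exact: (@fubini_tonelli _ _ (measurableTypeR R) (measurableTypeR R) R mu mu f mf f0).
Qed.

Let weight (al x : R) : R := kpow al x * expR (- x).

Let measurable_weight al : measurable_fun setT (weight al).
Proof.
apply: measurable_funM; first exact: measurable_kpow.
by apply: measurableT_comp => //; exact: measurableT_comp.
Qed.

Let weight_ge0 al x : 0 <= weight al x.
Proof. by rewrite mulr_ge0 ?kpow_ge0 ?expR_ge0. Qed.

Lemma GammaE (al : R) : Gamma al = \int[mu]_x (kpow al x * expR (- x)).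
Proof.
rewrite /Gamma Rintegral_mkcond; apply: eq_Rintegral => x _.
rewrite restrictE mem_setE in_itv/= andbT /kpow; case: ifP => //.
by rewrite mul0r.
Qed.

(** For x >= 1 one has exp x >= (x / N) ^ N, so the integrand is dominated by a
    multiple of x ^ -2. *)
Lemma integral_weight_lty (al : R) : 0 < al ->
  (\int[mu]_x (kpow al x * expR (- x))%:E < +oo)%E.
Proof.
move=> al0; rewrite -[X in integral _ X](setUv `]-oo, 1%R]%classic) ge0_integral_setU//=; last 4 first.
- exact: measurableC.
- by apply/measurable_EFinP; exact: (measurable_funTS (measurable_weight al)).
- by move=> x _; rewrite lee_fin; exact: weight_ge0.
- by apply/disj_set2P; rewrite setICr.
rewrite lte_add_pinfty//.
  apply: le_lt_trans (integral_powR_head al0 (@ltr01 R)).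
  rewrite integral_mkcond [leRHS]integral_mkcond; apply: ge0_le_integral => //.
  - by move=> x _; apply: erestrict_ge0 => y _; rewrite lee_fin; exact: weight_ge0.
  - apply/(measurable_restrictT _ _).1 => //; apply: measurable_funTS.
    by apply/measurable_EFinP; exact: measurable_weight.
  - apply/(measurable_restrictT _ _).1 => //; apply: measurable_funTS.
    by apply/measurable_EFinP; exact: measurable_powR.
  - move=> x _; rewrite !erestrictE !mem_setE !in_itv/=.
    have [x0|x0] := ltP 0 x; last first.
      by case: ifP => // _; rewrite /kpow ltNge x0 mul0r.
    case: ifP => // _; rewrite lee_fin /kpow x0 ler_piMr ?powR_ge0//.
    by rewrite -expR0 ler_expR oppr_le0 ltW.
rewrite setCitvl.
pose N := (Num.truncn (al + 1)).+1.
have NE : al + 1 <= N%:R by apply/ltW/truncnS_gt.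
have N0 : (0 : R) < N%:R by rewrite ltr0n.
have key (x : R) : 1 <= x -> kpow al x * expR (- x) <= N%:R ^+ N * x `^ (- 1 - 1).
  move=> x1; have x0 := lt_le_trans ltr01 x1.
  have h1 : (x / N%:R) ^+ N <= expR x.
    have -> : expR x = expR (x / N%:R) ^+ N.
      by rewrite -expRM_natl mulrC divfK// gt_eqF.
    apply: lerXn2r; rewrite ?nnegrE ?expR_ge0 ?divr_ge0 ?ltW//.
    apply: lt_le_trans (expR_ge1Dx _); by rewrite ltrDr.
  rewrite /kpow x0 expRN ler_pdivrMr ?expR_gt0//.
  apply: (@le_trans _ _ (N%:R ^+ N * x `^ (-1 - 1) * (x / N%:R) ^+ N)); last first.
    by rewrite ler_wpM2l// mulr_ge0 ?exprn_ge0 ?powR_ge0 ?ltW.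
  rewrite expr_div_n mulrC mulrA divfK ?expf_neq0 ?gt_eqF// mulrC.
  rewrite -powR_mulrn ?(ltW x0)// -powRD; last by apply/implyP => _; rewrite gt_eqF.
  by apply: (ler_powR x1); lra.
apply: (@le_lt_trans _ _ (\int[mu]_(x in `[1%R, +oo[) ((N%:R ^+ N)%:E * (x `^ (- 1 - 1))%:E))%E).
  apply: (@le_trans _ _ (\int[mu]_(x in `[1%R, +oo[) (kpow al x * expR (- x))%:E)%E).
    apply: ge0_subset_integral => //=.
    + by apply/measurable_EFinP; exact: (measurable_funTS (measurable_weight al)).
    + by move=> x _; rewrite lee_fin; exact: weight_ge0.
    + by move=> x /=; rewrite !in_itv/= !andbT => /ltW.
  apply: ge0_le_integral => //=.
  - by move=> x _; rewrite lee_fin; exact: weight_ge0.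
  - by apply/measurable_EFinP; exact: (measurable_funTS (measurable_weight al)).
  - apply: measurable_funTS; apply/measurable_EFinP.
    by apply: measurable_funM => //; exact: measurable_powR.
  - by move=> x; rewrite /= in_itv/= andbT => x1; rewrite -EFinM lee_fin key.
rewrite ge0_integralZl//=.
- rewrite lte_mul_pinfty// ?lee_fin ?exprn_ge0//.
  exact: integral_powR_tail.
- by apply/measurable_EFinP; apply: measurable_funTS; exact: measurable_powR.
- by move=> x _; rewrite lee_fin powR_ge0.
Qed.

(** Otherwise the integrand would vanish almost everywhere on ]0, 1[. *)
Lemma integral_weight_gt0 (al : R) :
  (0 < \int[mu]_x (kpow al x * expR (- x))%:E)%E.
Proof.
rewrite lt0e integral_ge0 ?andbT; last by move=> x _; rewrite lee_fin; exact: weight_ge0.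
apply/eqP => I0.
have : (\int[mu]_x `|(weight al x)%:E| = 0)%E.
  by rewrite -[RHS]I0; apply: eq_integral => x _; rewrite gee0_abs ?lee_fin.
have mw : measurable_fun setT (EFin \o weight al).
  by apply/measurable_EFinP; exact: measurable_weight.
move=> h; have [N [mN N0 sN]] : ae_eq mu setT (EFin \o weight al) (cst 0%E).
  exact/(ae_eq_integral_abs
    (mu : {measure set (measurableTypeR R) -> \bar R}) measurableT mw).
have : (mu `]0%R, 1%R[%classic <= mu N)%E.
  apply: le_measure; rewrite ?inE//.
  move=> x /=; rewrite in_itv/= => /andP[x0 x1]; apply: sN => /= /(_ I) [] /eqP.
  by rewrite gt_eqF// /weight mulr_gt0 ?kpow_gt0 ?expR_gt0.
by rewrite N0 lebesgue_measure_itv/= lte_fin ltr01 oppr0 adde0 lee_fin ler10.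
Qed.

Lemma integral_weight_EFin (al : R) : 0 < al ->
  (\int[mu]_x (kpow al x * expR (- x))%:E = (Gamma al)%:E)%E.
Proof.
move=> al0; rewrite GammaE /Rintegral fineK// ge0_fin_numE ?integral_weight_lty//.
by apply: integral_ge0 => x _; rewrite lee_fin; exact: weight_ge0.
Qed.

Lemma Gamma_gt0 (al : R) : 0 < al -> 0 < Gamma al.
Proof. by move=> al0; rewrite -lte_fin -integral_weight_EFin// integral_weight_gt0. Qed.

Lemma Gamma1 : Gamma 1 = 1 :> R.
Proof.
have -> : Gamma 1 = \int[mu]_(x in `]0, +oo[) expR (- x) :> R.
  by apply: eq_Rintegral => x _; rewrite subrr powRr0 mul1r.
rewrite /Rintegral integral_itv_obnd_cbnd; last first.
  apply: measurable_funTS; apply/measurable_EFinP.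
  by apply: measurableT_comp => //; exact: measurableT_comp.
rewrite integral_mkcond -[RHS]/(fine 1%:E) -(@integral_exponential_pdf R 1)//.
congr fine; apply: eq_integral => x _; rewrite erestrictE /exponential_pdf restrictE.
by case: ifP => // _; rewrite mul1r mulN1r.
Qed.

(** The substitution of s u for u scales both kernels, so the convolution is
    homogeneous in s; the constant is the Beta integral. *)
Lemma kpow_conv_homogeneous (al be s : R) :
  (\int[mu]_u (kpow al (s - u) * kpow be u)%:E =
   \int[mu]_u (kpow al (1 - u) * kpow be u)%:E * (kpow (al + be) s)%:E)%E.
Proof.
have mf (r : R) : measurable_fun setT (fun u : R => (kpow al (r - u) * kpow be u)%:E).
  apply/measurable_EFinP; apply: measurable_funM; first exact: measurable_kpowBr.
  exact: measurable_kpow.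
have [s0|s0] := leP s 0.
  rewrite [kpow _ s]kpow_le0// mule0 integral0_eq// => u _.
  have [u0|u0] := leP u 0; first by rewrite (kpow_le0 be u0) mulr0.
  by rewrite (@kpow_le0 _ al) ?mul0r// subr_le0 (le_trans s0)// ltW.
rewrite (@ge0_integral_affine _ s 0 _ s0 (mf s)); last first.
  by move=> u; rewrite lee_fin mulr_ge0// kpow_ge0.
transitivity (s%:E * \int[mu]_u ((s `^ (al - 1) * s `^ (be - 1))%:E *
    (kpow al (1 - u) * kpow be u)%:E))%E.
  congr (_ * _)%E; apply: eq_integral => u _.
  rewrite addr0 -EFinM -{1}(mulr1 s) -mulrBr !kpowM//; congr EFin; ring.
rewrite ge0_integralZl//=; [|exact: mf| |]; last first.
- by rewrite lee_fin mulr_ge0 ?powR_ge0.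
- by move=> u _; rewrite lee_fin mulr_ge0 ?kpow_ge0.
rewrite muleA muleC; congr (_ * _)%E; rewrite -EFinM; congr EFin.
rewrite /kpow s0 -[X in X * _](powRr1 (ltW s0)) -!powRD ?(gt_eqF s0) ?implybT//.
by congr (_ `^ _); ring.
Qed.

(** The integral over u and v of u^(be - 1) v^(al - 1) exp(- u - v), computed along
    the lines u + v = s. *)
Lemma Gamma_product (al be : R) : 0 < al -> 0 < be ->
  ((Gamma al)%:E * (Gamma be)%:E =
   \int[mu]_u (kpow al (1 - u) * kpow be u)%:E * (Gamma (al + be))%:E)%E.
Proof.
move=> al0 be0; have albe0 := addr_gt0 al0 be0.
rewrite -(integral_weight_EFin al0) -(integral_weight_EFin be0) -(integral_weight_EFin albe0).
set Ga := (X in (X * _)%E = _).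
have Ga0 : (0 <= Ga)%E by apply: integral_ge0 => x _; rewrite lee_fin; exact: weight_ge0.
rewrite muleC -ge0_integralZr//; last 2 first.
- by apply/measurable_EFinP; exact: measurable_weight.
- by move=> x _; rewrite lee_fin; exact: weight_ge0.
pose f (z : R * R) : \bar R := (kpow be z.1 * (kpow al (z.2 - z.1) * expR (- z.2)))%:E.
have mf : measurable_fun setT f.
  apply/measurable_EFinP; apply: measurable_funM.
    by apply: (measurableT_comp (measurable_kpow be)).
  apply: measurable_funM; first by apply: (measurableT_comp (measurable_kpow al)); exact: measurable_funB.
  by apply: measurableT_comp => //; exact: measurableT_comp.
have f0 z : (0 <= f z)%E by rewrite lee_fin !mulr_ge0 ?kpow_ge0 ?expR_ge0.
transitivity (\int[mu]_u \int[mu]_s f (u, s))%E.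
  apply: eq_integral => u _.
  have -> : Ga = (\int[mu]_s (weight al (s - u))%:E)%E.
    rewrite (@ge0_integral_shift _ (- u) (fun s => (weight al s)%:E))//.
      by apply/measurable_EFinP; exact: measurable_weight.
    by move=> x; rewrite lee_fin; exact: weight_ge0.
  rewrite -ge0_integralZl//=.
  - apply: eq_integral => s _; rewrite /f/= -EFinM; congr EFin.
    rewrite /weight -mulrA; congr (_ * _); rewrite mulrCA; congr (_ * _).
    by rewrite -expRD; congr expR; ring.
  - apply/measurable_EFinP; apply: (measurableT_comp (measurable_weight al)).
    exact: measurable_funB.
  - by move=> x _; rewrite lee_fin; exact: weight_ge0.
  - by rewrite lee_fin; exact: weight_ge0.
rewrite lebesgue_tonelli//.
rewrite -ge0_integralZl//=; last 3 first.
- by apply/measurable_EFinP; exact: measurable_weight.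
- by move=> x _; rewrite lee_fin; exact: weight_ge0.
- by apply: integral_ge0 => x _; rewrite lee_fin mulr_ge0 ?kpow_ge0.
apply: eq_integral => s _; rewrite [in RHS]EFinM muleA -kpow_conv_homogeneous.
rewrite -ge0_integralZr//; last 2 first.
- apply/measurable_EFinP; apply: measurable_funM; first exact: measurable_kpowBr.
  exact: measurable_kpow.
- by move=> u _; rewrite lee_fin mulr_ge0 ?kpow_ge0.
by apply: eq_integral => u _; rewrite /f/= -EFinM; congr EFin; ring.
Qed.

Lemma kpow_conv (al be s : R) : 0 < al -> 0 < be ->
  (\int[mu]_u (kpow al (s - u) * kpow be u)%:E =
   (Gamma al * Gamma be / Gamma (al + be) * kpow (al + be) s)%:E)%E.
Proof.
move=> al0 be0; have G0 := Gamma_gt0 (addr_gt0 al0 be0).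
rewrite kpow_conv_homogeneous EFinM; congr (_ * _)%E.
have := Gamma_product al0 be0.
case: (integral _ _ _) => [b| |] /=.
- by rewrite -!EFinM => -[->]; rewrite mulfK ?gt_eqF.
(* The Beta integral is finite, for otherwise the finite product of the two
   Gamma values would be infinite. *)
- by rewrite gt0_mulye// -EFinM.
- by rewrite gt0_mulNye// -EFinM.
Qed.

End gamma_beta.

(** * Transposition of integral operators *)

Section duality.
Context {R : realType}.
Local Notation mu := (@lebesgue_measure R).
Implicit Types (f g : R -> R) (al be t : R).

Lemma measurable_integral1 (h : R * R -> \bar R) : measurable_fun setT h ->
  measurable_fun setT (fun t => \int[mu]_u h (t, u))%E.
Proof.
move=> mh.
have -> : (fun t => \int[mu]_u h (t, u))%E =
    (fun t => \int[mu]_u (h^\+ (t, u)) - \int[mu]_u (h^\- (t, u)))%E.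
  apply/funext => t; rewrite integralE; congr (_ - _)%E.
    by apply: eq_integral => u _; rewrite !funeposE.
  by apply: eq_integral => u _; rewrite !funenegE.
apply: emeasurable_funB.
- exact: (@measurable_fun_fubini_tonelli_F _ _ (measurableTypeR R) (measurableTypeR R) R mu
    h^\+%E (measurable_funepos mh) (fun z => funepos_ge0 _ _)).
- exact: (@measurable_fun_fubini_tonelli_F _ _ (measurableTypeR R) (measurableTypeR R) R mu
    h^\-%E (measurable_funeneg mh) (fun z => funeneg_ge0 _ _)).
Qed.

Lemma measurable_Rintegral1 (h : R * R -> R) : measurable_fun setT h ->
  measurable_fun setT (fun t => \int[mu]_u h (t, u)).
Proof.
move=> mh; have mh' : measurable_fun setT (EFin \o h) by exact/measurable_EFinP.
exact: (measurableT_comp (fine_measurable measurableT) (measurable_integral1 mh')).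
Qed.

Lemma measurable_swap_pair (h : R * R -> R) :
  measurable_fun setT h -> measurable_fun setT (fun z : R * R => h (z.2, z.1)).
Proof.
by move=> mh; exact: (measurableT_comp mh (@measurable_swap _ _ R R)).
Qed.

(** When the constant is 0 the function itself need not be integrable, but both
    sides vanish; Fubini yields integrability of the product only. *)
Lemma RintegralZl_integrable (c : R) (g : R -> R) :
  mu.-integrable setT (fun u => (c * g u)%:E) ->
  (\int[mu]_u (c * g u)%:E = (c * \int[mu]_u g u)%:E)%E.
Proof.
have [->|c0] := eqVneq c 0 => ig.
  by rewrite mul0r integral0_eq// => u _; rewrite mul0r.
have ig' : mu.-integrable setT (EFin \o g).
  apply: eq_integrable (integrableZl measurableT c^-1 ig) => // u _ /=.
  by rewrite -EFinM mulKf.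
rewrite -[RHS]fineK// -[LHS]fineK; last exact: integrable_fin_num.
by congr EFin; rewrite /= -RintegralZl.
Qed.

Let Fubini_adjoint_half (K : R * R -> R) f g :
  measurable_fun setT K -> measurable_fun setT f -> measurable_fun setT g ->
  (\int[mu]_t \int[mu]_u `|(f t * (K (t, u) * g u))%:E| < +oo)%E ->
  mu.-integrable setT (fun t => (f t * \int[mu]_u (K (t, u) * g u))%:E) /\
  (\int[mu]_t (f t * \int[mu]_u (K (t, u) * g u))%:E =
   \int[mu]_t \int[mu]_u (f t * (K (t, u) * g u))%:E)%E.
Proof.
move=> mK mf mg fin.
pose lam : {measure set (measurableTypeR R) -> \bar R} := mu.
pose h (z : R * R) : \bar R := (f z.1 * (K z * g z.2))%:E.
have mf1 : measurable_fun setT (fun z : R * R => f z.1) by exact: (measurableT_comp mf).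
have mg2 : measurable_fun setT (fun z : R * R => g z.2) by exact: (measurableT_comp mg).
have mh : measurable_fun setT h.
  by apply/measurable_EFinP; apply: measurable_funM => //; exact: measurable_funM.
have ih := (@integrable12ltyP _ _ (measurableTypeR R) (measurableTypeR R) R mu mu h mh).2 fin.
have mF : measurable_fun setT (fun t => f t * \int[mu]_u (K (t, u) * g u)).
  apply: measurable_funM => //.
  by apply: (@measurable_Rintegral1 (fun z => K z * g z.2)); exact: measurable_funM.
have aeF : (fun t => \int[mu]_u h (t, u))%E =
    (fun t => (f t * \int[mu]_u (K (t, u) * g u))%:E) %[ae lam in setT].
  by apply: filterS (ae_integrable1 ih) => t it _; exact: (@RintegralZl_integrable (f t) (fun u => K (t, u) * g u) it).
have mF' : measurable_fun setT (fun t => (f t * \int[mu]_u (K (t, u) * g u))%:E).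
  exact/measurable_EFinP.
split.
  exact: (@ae_eq_integrable _ (measurableTypeR R) R lam setT _ _ measurableT mF' aeF
    (integrable_fubini_F ih)).
exact/esym/(@ae_eq_integral_nomeas _ (measurableTypeR R) R lam setT _ _ measurableT mF' aeF).
Qed.

(** Fubini for f(t) K(t, u) g(u): the integral operator with kernel K, applied to
    g, is adjoint to the one with the transposed kernel, applied to f. *)
Lemma Fubini_adjoint (K : R * R -> R) f g :
  measurable_fun setT K -> measurable_fun setT f -> measurable_fun setT g ->
  (\int[mu]_t \int[mu]_u `|(f t * (K (t, u) * g u))%:E| < +oo)%E ->
  [/\ mu.-integrable setT (fun t => (f t * \int[mu]_u (K (t, u) * g u))%:E),
      mu.-integrable setT (fun u => (g u * \int[mu]_t (K (t, u) * f t))%:E) &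
      \int[mu]_t (f t * \int[mu]_u (K (t, u) * g u)) =
      \int[mu]_u (g u * \int[mu]_t (K (t, u) * f t))].
Proof.
move=> mK mf mg fin.
pose h (z : R * R) : \bar R := (f z.1 * (K z * g z.2))%:E.
have mf1 : measurable_fun setT (fun z : R * R => f z.1) by exact: (measurableT_comp mf).
have mg2 : measurable_fun setT (fun z : R * R => g z.2) by exact: (measurableT_comp mg).
have mh : measurable_fun setT h.
  by apply/measurable_EFinP; apply: measurable_funM => //; exact: measurable_funM.
have [i1 e1] := Fubini_adjoint_half mK mf mg fin.
have swapE u t : g u * (K (t, u) * f t) = f t * (K (t, u) * g u) by ring.
have fin' : (\int[mu]_u \int[mu]_t `|(g u * (K (t, u) * f t))%:E| < +oo)%E.
  have mah : measurable_fun setT (abse \o h) by exact: measurableT_comp.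
  have := lebesgue_tonelli mah (fun z => abse_ge0 (h z)) => /= E.
  rewrite E in fin; apply: le_lt_trans fin.
  by under eq_integral do under eq_integral do rewrite swapE.
have [i2 e2] := @Fubini_adjoint_half (fun z => K (z.2, z.1)) _ _
  (measurable_swap_pair mK) mg mf fin'.
split; [exact: i1|exact: i2|]; rewrite /Rintegral e1 e2; congr fine.
under [RHS]eq_integral do under eq_integral do rewrite swapE.
have ih := (@integrable12ltyP _ _ (measurableTypeR R) (measurableTypeR R) R mu mu h mh).2 fin.
exact: (Fubini ih).
Qed.

End duality.

(** * The fractional integral as a convolution *)

Section fractional_convolution.
Context {R : realType}.
Local Notation mu := (@lebesgue_measure R).
Implicit Types (f g : R -> R) (al be t : R).

Definition fracint al g t : R := (Gamma al)^-1 * \int[mu]_u (kpow al (t - u) * g u).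

Lemma measurable_fracint al g : measurable_fun setT g ->
  measurable_fun setT (fracint al g).
Proof.
move=> mg; apply: measurable_funM => //.
apply: (@measurable_Rintegral1 _ (fun z => kpow al (z.1 - z.2) * g z.2)).
apply: measurable_funM; first exact: measurable_kpowB.
exact: (measurableT_comp mg).
Qed.

Lemma kpow_conv_shift al be t u : 0 < al -> 0 < be ->
  (\int[mu]_s (kpow al (t - s) * kpow be (s - u))%:E =
   (Gamma al * Gamma be / Gamma (al + be) * kpow (al + be) (t - u))%:E)%E.
Proof.
move=> al0 be0; rewrite -(kpow_conv (t - u) al0 be0).
rewrite -(@ge0_integral_shift _ u (fun s => (kpow al (t - s) * kpow be (s - u))%:E)).
- by apply: eq_integral => s _; rewrite addrK opprD addrA addrAC.
- apply/measurable_EFinP; apply: measurable_funM; first exact: measurable_kpowBr.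
  exact: measurable_kpowBl.
- by move=> x; rewrite lee_fin mulr_ge0 ?kpow_ge0.
Qed.

(** Fubini reduces the iterated integral to the convolution of the two kernels. *)
Lemma fracint_semigroup_integrable al be g t :
  0 < al -> 0 < be -> measurable_fun setT g ->
  mu.-integrable setT (fun u => (kpow (al + be) (t - u) * g u)%:E) ->
  mu.-integrable setT (fun s => (kpow al (t - s) * fracint be g s)%:E) /\
  fracint al (fracint be g) t = fracint (al + be) g t.
Proof.
move=> al0 be0 mg ig.
have Gal := Gamma_gt0 al0; have Gbe := Gamma_gt0 be0.
have Galbe := Gamma_gt0 (addr_gt0 al0 be0).
set c := Gamma al * Gamma be / Gamma (al + be).
have c0 : 0 < c := divr_gt0 (mulr_gt0 Gal Gbe) Galbe.
have mK : measurable_fun setT (fun z : R * R => kpow be (z.1 - z.2)).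
  exact: measurable_kpowB.
have mf : measurable_fun setT (fun s : R => kpow al (t - s)) by exact: measurable_kpowBr.
have fin : (\int[mu]_s \int[mu]_u `|(kpow al (t - s) * (kpow be (s - u) * g u))%:E| < +oo)%E.
  rewrite (@lebesgue_tonelli _ (fun z : R * R =>
    `|(kpow al (t - z.1) * (kpow be (z.1 - z.2) * g z.2))%:E|%E)); last 2 first.
  - apply: measurableT_comp => //; apply/measurable_EFinP; apply: measurable_funM.
      exact: (measurableT_comp mf).
    by apply: measurable_funM => //; exact: (measurableT_comp mg).
  - by move=> z; exact: abse_ge0.
  have /integrableP[_] := integrableZl measurableT c ig.
  congr (_ < _)%E; apply: eq_integral => u _.
  transitivity (`|g u|%:E * (c * kpow (al + be) (t - u))%:E)%E.
    by rewrite -!EFinM /= normrM (gtr0_norm c0) normrM ger0_norm ?kpow_ge0//; congr EFin; ring.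
  rewrite -kpow_conv_shift// -ge0_integralZl//=.
  - apply: eq_integral => s _; rewrite -EFinM !normrM ![`|kpow _ _|]ger0_norm ?kpow_ge0//.
    by congr EFin; ring.
  - apply/measurable_EFinP; apply: measurable_funM; first exact: measurable_kpowBr.
    exact: measurable_kpowBl.
  - by move=> s _; rewrite lee_fin mulr_ge0 ?kpow_ge0.
have [i1 _ e] := Fubini_adjoint mK mf mg fin; split.
  apply: eq_integrable (integrableZl measurableT (Gamma be)^-1 i1) => // s _ /=.
  by rewrite -EFinM mulrCA.
rewrite /fracint.
transitivity ((Gamma al)^-1 * ((Gamma be)^-1 *
    \int[mu]_s (kpow al (t - s) * \int[mu]_u (kpow be (s - u) * g u)))).
  congr (_ * _); rewrite -RintegralZl//.
  by apply: eq_Rintegral => s _; rewrite mulrCA.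
rewrite e.
have -> : \int[mu]_u (g u * \int[mu]_s (kpow be (s - u) * kpow al (t - s))) =
    \int[mu]_u (c * (kpow (al + be) (t - u) * g u)).
  apply: eq_Rintegral => u _; rewrite mulrA [RHS]mulrC; congr (_ * _).
  rewrite /Rintegral; under eq_integral do rewrite mulrC.
  by rewrite kpow_conv_shift.
rewrite RintegralZl; [|exact: measurableT|exact: ig]; rewrite /c.
move: Gal Gbe Galbe (\int[mu]_x _); move: (Gamma al) (Gamma be) (Gamma (al + be)).
move=> x y z x0 y0 z0 w; field.
by rewrite (gt_eqF x0) (gt_eqF y0) (gt_eqF z0).
Qed.

Lemma fracint_semigroup al be g t : 0 < al -> 0 < be -> measurable_fun setT g ->
  mu.-integrable setT (fun u => (kpow (al + be) (t - u) * g u)%:E) ->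
  fracint al (fracint be g) t = fracint (al + be) g t.
Proof. by move=> al0 be0 mg ig; have [] := fracint_semigroup_integrable al0 be0 mg ig. Qed.

(** For orders at least 1 the kernel is bounded on the support of g. *)
Lemma integrable_kpow_ge1 al g a t : 1 <= al ->
  mu.-integrable setT (EFin \o g) -> (forall u, u <= a -> g u = 0) ->
  mu.-integrable setT (fun u => (kpow al (t - u) * g u)%:E).
Proof.
move=> al1 ig g0.
have mg := integrable_measurable ig.
apply: (le_integrable measurableT _ _ (integrableZl measurableT (kpow al (t - a)) ig)).
  apply/measurable_EFinP; apply: measurable_funM => //; exact: measurable_kpowBr.
move=> u _ /=; rewrite lee_fin !normrM ![`|kpow _ _|]ger0_norm ?kpow_ge0//.
have [ua|au] := leP u a; first by rewrite g0// normr0 !mulr0.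
have [tu|ut] := leP t u.
  by rewrite kpow_le0 ?subr_le0// mul0r mulr_ge0 ?kpow_ge0.
rewrite ler_wpM2r// /kpow !subr_gt0 ut (lt_trans au ut).
by rewrite ge0_ler_powR ?nnegrE ?subr_ge0 ?(ltW ut) ?(ltW (lt_trans au ut))// lerB// ltW.
Qed.

(** For fixed u, only t between u and b matter; there the kernel has an integral
    bounded by that of s^(al - 1) on ]0, |b - a| + 1], uniformly in u. *)
Lemma energy_bounded_L1 al f g a b (M : R) : 0 < al ->
  measurable_fun setT f -> mu.-integrable setT (EFin \o g) ->
  (forall t, `|f t| <= M) ->
  (forall t, b <= t -> f t = 0) -> (forall u, u <= a -> g u = 0) ->
  (\int[mu]_t \int[mu]_u `|(f t * (kpow al (t - u) * g u))%:E| < +oo)%E.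
Proof.
move=> al0 mf ig fM fb ga.
have mg := integrable_measurable ig.
pose C := (\int[mu]_(s in `]0%R, (`|b - a| + 1)%R]) (s `^ (al - 1))%:E)%E.
have Cfin : (C < +oo)%E by apply: integral_powR_head => //; rewrite ltr_wpDl.
have C0 : (0 <= C)%E by apply: integral_ge0 => s _; rewrite lee_fin powR_ge0.
rewrite (@lebesgue_tonelli _ (fun z : R * R =>
    `|(f z.1 * (kpow al (z.1 - z.2) * g z.2))%:E|%E)); last 2 first.
- apply: measurableT_comp => //; apply/measurable_EFinP; apply: measurable_funM.
    exact: (measurableT_comp mf).
  by apply: measurable_funM; [exact: measurable_kpowB|exact: (measurableT_comp mg)].
- by move=> z; exact: abse_ge0.
have M0 : 0 <= M := le_trans (normr_ge0 _) (fM 0).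
apply: (@le_lt_trans _ _ (\int[mu]_u ((M%:E * C) * `|(g u)%:E|))%E); last first.
  rewrite ge0_integralZl//.
  - have /integrableP[_ gfin] := ig.
    rewrite lte_mul_pinfty ?mule_ge0// ge0_fin_numE ?mule_ge0//.
    by rewrite lte_mul_pinfty.
  - by apply: measurableT_comp => //; exact/measurable_EFinP.
  - by rewrite mule_ge0.
pose k0 : R -> R := (@powR R ^~ (al - 1)) \_ `]0, `|b - a| + 1].
have mk0 : measurable_fun setT k0.
  by apply/(measurable_restrictT _ _).1 => //; apply: measurable_funTS; exact: measurable_powR.
have k00 s : 0 <= k0 s by rewrite /k0 restrictE; case: ifP => // _; exact: powR_ge0.
have mk0u (u : R) : measurable_fun setT (fun t : R => k0 (t - u)).
  by apply: (measurableT_comp mk0); exact: measurable_funB.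
apply: ge0_le_integral => //.
- by move=> u _; apply: integral_ge0 => t _; exact: abse_ge0.
- apply: (@measurable_integral1 _
    (fun z => `|(f z.2 * (kpow al (z.2 - z.1) * g z.1))%:E|%E)).
  apply: measurableT_comp => //; apply/measurable_EFinP; apply: measurable_funM.
    exact: (measurableT_comp mf).
  apply: measurable_funM; last exact: (measurableT_comp mg).
  exact: (measurable_swap_pair (@measurable_kpowB R al)).
- by apply: measurable_funeM; apply: measurableT_comp => //; exact/measurable_EFinP.
- move=> u _.
  have -> : C = (\int[mu]_t (k0 (t - u))%:E)%E.
    rewrite (@ge0_integral_shift _ (- u) (EFin \o k0))//; last exact/measurable_EFinP.
    by rewrite /C integral_mkcond; apply: eq_integral => s _; rewrite erestrictE /k0 /= restrictE; case: ifP.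
  rewrite -muleA -ge0_integralZr//; last 2 first.
  - by apply/measurable_EFinP; exact: mk0u.
  - by move=> t _; rewrite lee_fin.
  rewrite -ge0_integralZl//=; last 2 first.
  - apply: emeasurable_funM => //; apply/measurable_EFinP; exact: mk0u.
  - by move=> t _; rewrite mule_ge0 ?lee_fin.
  apply: ge0_le_integral => //.
  + have mku : measurable_fun setT (fun t : R => f t * (kpow al (t - u) * g u)).
      apply: (measurable_funM mf); apply: (measurable_funM _ (measurable_cst (g u))).
      exact: measurable_kpowBl.
    by apply/measurable_EFinP; exact: (measurableT_comp (@normr_measurable R setT) mku).
  + apply: measurable_funeM; apply: emeasurable_funM => //.
    by apply/measurable_EFinP; exact: mk0u.
  + move=> t _; rewrite -!EFinM lee_fin !normrM [`|kpow _ _|]ger0_norm ?kpow_ge0//.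
    have [ua|au] := leP u a; first by rewrite ga// normr0 !mulr0.
    have [bt|tb] := leP b t; first by rewrite fb// normr0 mul0r !mulr_ge0.
    have [tu|ut] := leP t u; first by rewrite kpow_le0 ?subr_le0// mul0r mulr0 !mulr_ge0.
    have -> : k0 (t - u) = kpow al (t - u).
      rewrite /k0 restrictE /kpow subr_gt0 ut mem_setE in_itv/= subr_gt0 ut/=.
      rewrite ifT// (le_trans (lerB (ltW tb) (ltW au)))//.
      by rewrite (le_trans (ler_norm _))// lerDl.
    rewrite mulrA [leRHS]mulrA ler_wpM2r// ler_wpM2r ?kpow_ge0//.
Qed.

End fractional_convolution.

(** * The Hardy-Littlewood-Sobolev inequality *)

Section Hardy_Littlewood_Sobolev.
Context {R : realType}.
Local Notation mu := (@lebesgue_measure R).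
Let lam : {sigma_finite_measure set (measurableTypeR R) -> \bar R} := mu.
Local Notation mu2 := (lam \x lam)%E.
Implicit Types (f g F G : R -> R) (al be x y : R).

(** The kernel up to distance 1, and an integrable decay c > 1 beyond: the power
    al - 1 itself is not integrable at infinity. *)
Definition hls_profile al c (v : R) : R := if v < 1 then kpow al v else v `^ (- c).

Lemma hls_profile_ge0 al c v : 0 <= hls_profile al c v.
Proof. by rewrite /hls_profile; case: ifP; rewrite ?kpow_ge0 ?powR_ge0. Qed.

Lemma measurable_hls_profile al c : measurable_fun setT (hls_profile al c).
Proof.
apply: measurable_fun_ifT => //; first exact: measurable_fun_ltr.
- exact: measurable_kpow.
Qed.

Lemma integrable_powR_itv al (i : interval R) :
  (\int[mu]_(s in [set` i]) (s `^ al)%:E < +oo)%E ->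
  mu.-integrable setT (EFin \o ((@powR R ^~ al) \_ [set` i])).
Proof.
move=> fin; apply/(@integrable_restrictT _ [set` i]) => //.
apply/integrableP; split.
  have h : measurable_fun [set` i] (@powR R ^~ al).
    by apply: measurable_funTS; exact: measurable_powR.
  exact/measurable_EFinP.
by under eq_integral do rewrite gee0_abs ?lee_fin ?powR_ge0//.
Qed.

Lemma integrable_hls_profile al c : 0 < al -> 1 < c ->
  mu.-integrable setT (EFin \o hls_profile al c).
Proof.
move=> al0 c1.
have i1 := integrable_powR_itv (integral_powR_head al0 (@ltr01 R)).
have c1' : 0 < c - 1 by rewrite subr_gt0.
have := integral_powR_tail c1'; rewrite (_ : - (c - 1) - 1 = - c); last by ring.
move=> /integrable_powR_itv i2.
apply: (le_integrable measurableT _ _ (integrableD measurableT i1 i2)).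
  by apply/measurable_EFinP; exact: measurable_hls_profile.
move=> v _ /=; rewrite lee_fin ger0_norm ?hls_profile_ge0//.
apply: le_trans (ler_norm _); rewrite !restrictE !mem_setE !in_itv/= /hls_profile.
have [v1|v1] := ltP v 1; last first.
  by rewrite andbT lerDr; case: ifP => // _; exact: powR_ge0.
rewrite addr0 (ltW v1) andbT /kpow; by case: ifP.
Qed.

(** Both halves of the line contribute the integral of k. *)
Lemma integrable_norm_profile (k : R -> R) : (forall v : R, v <= 0 -> k v = 0) ->
  mu.-integrable setT (EFin \o k) ->
  (forall v, 0 <= k v) ->
  (\int[mu]_v (k `|v|)%:E < +oo)%E.
Proof.
move=> k0 ik kge0.
have mk := integrable_measurable ik.
have -> : (\int[mu]_v (k `|v|)%:E = \int[mu]_v ((k v)%:E + (k (- v))%:E))%E.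
  apply: eq_integral => v _; rewrite -EFinD; congr EFin.
  have [v0|v0] := leP 0 v.
    by rewrite ger0_norm// (k0 (- v)) ?addr0// oppr_le0.
  by rewrite ltr0_norm// (k0 v) ?add0r// ltW.
have mk1 : measurable_fun setT (fun v => (k v)%:E) by exact/measurable_EFinP.
have mk2 : measurable_fun setT (fun v : R => (k (- v))%:E).
  by apply/measurable_EFinP; apply: (measurableT_comp mk).
have nn v : (0 <= (k v)%:E)%E by rewrite lee_fin.
rewrite ge0_integralD//.
rewrite (ge0_integral_opp mk1)//.
by rewrite lte_add_pinfty//; exact: (integrable_lty measurableT ik).
Qed.

Lemma integrable_prod_L1 F G :
  mu.-integrable setT (EFin \o F) -> mu.-integrable setT (EFin \o G) ->
  mu2.-integrable setT (fun z => (F z.1 * G z.2)%:E).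
Proof.
move=> iF iG.
have mF := integrable_measurable iF.
have mG := integrable_measurable iG.
apply/integrable12ltyP.
  apply/measurable_EFinP; apply: measurable_funM.
    exact: (measurableT_comp mF).
  exact: (measurableT_comp mG).
have /integrableP[_ fF] := iF; have /integrableP[_ fG] := iG.
have fG0 : (0 <= \int[mu]_u `|(G u)%:E|)%E by apply: integral_ge0.
have -> : (\int[mu]_t \int[mu]_u `|(F t * G u)%:E| =
    \int[mu]_t (`|(F t)%:E| * \int[mu]_u `|(G u)%:E|))%E.
  apply: eq_integral => t _.
  rewrite -ge0_integralZl//=.
  - by apply: eq_integral => u _; rewrite normrM EFinM.
  - by apply/measurable_EFinP; exact: measurableT_comp.
rewrite ge0_integralZr//; first last.
  by apply/measurable_EFinP; exact: measurableT_comp.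
by rewrite lte_mul_pinfty// ?integral_ge0// ge0_fin_numE// integral_ge0.
Qed.

(** The self-similar kernel F(t)^2 k(F(t) |t - u|) has mass proportional to F(t)
    in the variable u. *)
Lemma integrable_selfsimilar (k : R -> R) F :
  measurable_fun setT k -> (forall v, 0 <= k v) ->
  (\int[mu]_v (k `|v|)%:E < +oo)%E ->
  (forall t, 0 <= F t) -> mu.-integrable setT (EFin \o F) ->
  mu2.-integrable setT (fun z => (F z.1 ^+ 2 * k (F z.1 * `|z.2 - z.1|))%:E).
Proof.
move=> mk k0 kfin F0 iF.
have mF := integrable_measurable iF.
have mF1 : measurable_fun setT (fun z : R * R => F z.1) by exact: (measurableT_comp mF).
apply/integrable12ltyP.
  apply/measurable_EFinP; apply: measurable_funM; first exact: measurable_funX.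
  apply: (measurableT_comp mk); apply: measurable_funM => //.
  by apply: measurableT_comp => //; exact: measurable_funB.
have -> : (\int[mu]_t \int[mu]_u `|(F t ^+ 2 * k (F t * `|u - t|))%:E| =
    \int[mu]_t (`|(F t)%:E| * \int[mu]_v (k `|v|)%:E))%E.
  apply: eq_integral => t _; rewrite /= ger0_norm//.
  have [Ft0|Ft0] := eqVneq (F t) 0.
    by rewrite Ft0 mul0e integral0_eq// => u _; rewrite expr0n/= mul0r normr0.
  have Ftp : 0 < F t by rewrite lt_def Ft0 F0.
  have mkn : measurable_fun setT (fun v : R => (k `|v|)%:E).
    by apply/measurable_EFinP; apply: measurableT_comp.
  rewrite (@ge0_integral_affine _ (F t) (- (F t * t)) _ Ftp mkn)//; last by move=> v; rewrite lee_fin.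
  rewrite muleA -EFinM -ge0_integralZl//=.
  - apply: eq_integral => u _; rewrite ger0_norm ?mulr_ge0// EFinM -expr2.
    by rewrite -mulrBr normrM (ger0_norm (F0 t)).
  - apply/measurable_EFinP; apply: (measurableT_comp mk); apply: measurableT_comp => //.
    apply: measurable_funD => //; exact: measurable_funM.
  - by move=> u _; rewrite lee_fin.
  - by rewrite lee_fin mulr_ge0.
have K0 : (0 <= \int[mu]_v (k `|v|)%:E)%E by apply: integral_ge0 => v _; rewrite lee_fin.
rewrite ge0_integralZr//; first last.
  by apply/measurable_EFinP; exact: measurableT_comp.
have /integrableP[_ fF] := iF.
by rewrite lte_mul_pinfty// ?integral_ge0// ge0_fin_numE// integral_ge0.
Qed.

Lemma integrable_swap (h : R * R -> \bar R) : mu2.-integrable setT h ->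
  mu2.-integrable setT (fun z => h (z.2, z.1)).
Proof.
move=> ih; have mh := measurable_int _ ih.
have fin := (integrable12ltyP lam lam mh).1 ih.
have mh' : measurable_fun setT (fun z : measurableTypeR R * measurableTypeR R => h (z.2, z.1)).
  exact: (measurableT_comp mh (@measurable_swap _ _ (measurableTypeR R) (measurableTypeR R))).
exact: (integrable21ltyP lam lam mh').2.
Qed.

End Hardy_Littlewood_Sobolev.

Section energy.
Context {R : realType}.
Local Notation mu := (@lebesgue_measure R).
Let lam : {sigma_finite_measure set (measurableTypeR R) -> \bar R} := mu.
Local Notation mu2 := (lam \x lam)%E.
Implicit Types (f g F G : R -> R) (al be x y : R).

(** Both factors are at most the same power of the maximum of A and B. *)
Lemma powR_convex_le (A B y : R) : 0 <= A -> 0 <= B -> 0 < y -> y < 1 ->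
  A `^ y * B `^ (1 - y) <= A + B.
Proof.
move=> A0 B0 y0 y1; set M := Num.max A B.
have AM : A <= M by rewrite le_max lexx.
have BM : B <= M by rewrite le_max lexx orbT.
have M0 := le_trans A0 AM.
apply: (@le_trans _ _ (M `^ y * M `^ (1 - y))).
  by rewrite ler_pM ?powR_ge0// ge0_ler_powR ?nnegrE// ?subr_ge0 ltW.
rewrite -powRD; last by rewrite subrKC oner_eq0.
rewrite subrKC powRr1//.
by rewrite /M; case: (leP A B) => _; rewrite ?lerDl ?lerDr.
Qed.

(** After rescaling the distance by F, the case v < 1 uses only G <= F and the
    case v >= 1 is the weighted arithmetic-geometric inequality. *)
Lemma hls_pointwise al x y (F G s : R) : 0 < x -> 0 < y -> y < 1 ->
  x + y = 1 + al -> 0 <= G -> G <= F -> 0 < s ->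
  F `^ x * (s `^ (al - 1) * G `^ y) <=
    F * G + F ^+ 2 * hls_profile al ((1 - al) / (1 - y)) (F * s).
Proof.
move=> x0 y0 y1 xy G0 GF s0.
have F0 := le_trans G0 GF.
move: F0; rewrite le_eqVlt => /predU1P[F0|Fp].
  by rewrite -F0 powR0 ?gt_eqF// !mul0r addr_ge0// mulr_ge0 ?exprn_ge0 ?hls_profile_ge0.
have r0 : 0 <= G / F by rewrite divr_ge0// ltW.
have v0 : 0 < F * s by rewrite mulr_gt0.
have sE : s `^ (al - 1) = (F * s) `^ (al - 1) * F `^ (1 - al).
  rewrite powRM ?ltW// mulrAC -powRD; last by apply/implyP => _; rewrite gt_eqF.
  by rewrite (_ : al - 1 + (1 - al) = 0) ?powRr0 ?mul1r//; ring.
have FE : F `^ x * F `^ (1 - al) * F `^ y = F ^+ 2.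
  rewrite -!powRD; [|by apply/implyP => _; rewrite gt_eqF..].
  by rewrite -powR_mulrn ?ltW//; congr (_ `^ _); rewrite addrAC xy; ring.
have GE : G `^ y = F `^ y * (G / F) `^ y.
  by rewrite -powRM ?(ltW Fp)// mulrC divfK// gt_eqF.
have -> : F `^ x * (s `^ (al - 1) * G `^ y) =
    F ^+ 2 * ((F * s) `^ (al - 1) * (G / F) `^ y).
  by rewrite sE GE -FE; ring.
have -> : F * G = F ^+ 2 * (G / F) by field; rewrite gt_eqF.
rewrite -mulrDr ler_wpM2l ?exprn_ge0 ?(ltW Fp)// /hls_profile.
have [v1|v1] := ltP (F * s) 1.
  rewrite /kpow v0 -[leLHS]add0r lerD// ler_piMr ?powR_ge0//.
  have : (G / F) `^ y <= 1 `^ y.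
    by rewrite ge0_ler_powR ?nnegrE// ?(ltW y0)// ler_pdivrMr// mul1r.
  by rewrite powR1.
set c := (1 - al) / (1 - y).
have -> : (F * s) `^ (al - 1) = ((F * s) `^ (- c)) `^ (1 - y).
  rewrite -powRrM; congr (_ `^ _); rewrite /c mulNr divfK ?opprB//.
  by rewrite gt_eqF// subr_gt0.
by rewrite mulrC powR_convex_le// powR_ge0.
Qed.

Lemma measurable_energy al f g : measurable_fun setT f -> measurable_fun setT g ->
  measurable_fun setT (fun z : measurableTypeR R * measurableTypeR R =>
    f z.1 * (kpow al (z.1 - z.2) * g z.2)).
Proof.
move=> mf mg; apply: measurable_funM; first exact: (measurableT_comp mf).
by apply: measurable_funM; [exact: measurable_kpowB|exact: (measurableT_comp mg)].
Qed.

(** The Hardy-Littlewood-Sobolev inequality. At each point (t, u) the larger of F t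
    and G u sets the scale in [hls_pointwise], and the two self-similar kernels so
    obtained are integrable by [integrable_selfsimilar]. The exponents x and y
    exceed al, which makes the tails of the profiles integrable. *)
Lemma energy_critical al x y f g F G : 0 < al -> al < 1 ->
  0 < x -> x < 1 -> 0 < y -> y < 1 -> x + y = 1 + al ->
  measurable_fun setT f -> measurable_fun setT g ->
  mu.-integrable setT (EFin \o F) -> mu.-integrable setT (EFin \o G) ->
  (forall t, 0 <= F t) -> (forall t, 0 <= G t) ->
  (forall t, `|f t| <= F t `^ x) -> (forall t, `|g t| <= G t `^ y) ->
  mu2.-integrable setT (fun z => (f z.1 * (kpow al (z.1 - z.2) * g z.2))%:E).
Proof.
move=> al0 al1 x0 x1 y0 y1 xy mf mg iF iG F0 G0 fF gG.
pose k (c v : R) := hls_profile al ((1 - al) / (1 - c)) v.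
have kfin c : al < c -> c < 1 -> (\int[mu]_v (k c `|v|)%:E < +oo)%E.
  move=> alc c1; apply: integrable_norm_profile.
  - move=> v v0; rewrite /k /hls_profile kpow_le0//.
    by rewrite (le_lt_trans v0).
  - apply: integrable_hls_profile => //.
    by rewrite ltr_pdivlMr ?subr_gt0// mul1r ltrD2l ltrN2.
  - by move=> v; exact: hls_profile_ge0.
have mk c : measurable_fun setT (k c) by exact: measurable_hls_profile.
have k0 c v : 0 <= k c v by exact: hls_profile_ge0.
have aly : al < y by lra.
have alx : al < x by lra.
have i1 := integrable_prod_L1 iF iG.
have i2 := integrable_selfsimilar (mk y) (k0 y) (kfin _ aly y1) F0 iF.
have i3 := integrable_swap (integrable_selfsimilar (mk x) (k0 x) (kfin _ alx x1) G0 iG).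
apply: (le_integrable measurableT _ _ (integrableD measurableT (integrableD measurableT i1 i2) i3)).
  by apply/measurable_EFinP; exact: measurable_energy.
move=> [t u] _ /=; rewrite lee_fin.
apply: le_trans (ler_norm _).
rewrite !normrM [`|kpow _ _|]ger0_norm ?kpow_ge0//.
apply: (@le_trans _ _ (F t `^ x * (kpow al (t - u) * G u `^ y))).
  by rewrite ler_pM// ?mulr_ge0 ?kpow_ge0// ler_wpM2l ?kpow_ge0.
have T0 : 0 <= F t * G u by rewrite mulr_ge0.
have T1 (c v : R) : 0 <= F t ^+ 2 * k c v by rewrite mulr_ge0 ?exprn_ge0.
have T2 (c v : R) : 0 <= G u ^+ 2 * k c v by rewrite mulr_ge0 ?exprn_ge0.
have [tu|ut] := leP t u.
  by rewrite kpow_le0 ?subr_le0// mul0r mulr0 !addr_ge0.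
have s0 : 0 < t - u by rewrite subr_gt0.
rewrite /kpow s0 [`|u - t|]distrC gtr0_norm//.
have [GF|/ltW FG] := leP (G u) (F t).
  rewrite -[leLHS]addr0 lerD// /k; exact: hls_pointwise.
have yx : y + x = 1 + al by rewrite addrC.
have -> : F t `^ x * ((t - u) `^ (al - 1) * G u `^ y) =
    G u `^ y * ((t - u) `^ (al - 1) * F t `^ x) by ring.
apply: le_trans (hls_pointwise y0 x0 x1 yx (F0 t) FG s0) _.
by rewrite [F t * G u]mulrC -addrA lerD2l lerDr T1.
Qed.

End energy.

(** * Finiteness of the energy for functions in Lp *)

Section energy_Lp.
Context {R : realType}.
Local Notation mu := (@lebesgue_measure R).
Let lam : {sigma_finite_measure set (measurableTypeR R) -> \bar R} := mu.
Local Notation mu2 := (lam \x lam)%E.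
Implicit Types (f g F G : R -> R) (al be x y : R).

Lemma integrable_conv_L1 F (k : R -> R) :
  mu.-integrable setT (EFin \o F) -> mu.-integrable setT (EFin \o k) ->
  mu2.-integrable setT (fun z => (F z.1 * k (z.1 - z.2))%:E).
Proof.
move=> iF ik.
have mF := integrable_measurable iF; have mk := integrable_measurable ik.
have mF1 : measurable_fun setT (fun z : R * R => F z.1) by exact: (measurableT_comp mF).
have mk1 : measurable_fun setT (fun z : R * R => k (z.1 - z.2)).
  by apply: (measurableT_comp mk); exact: measurable_funB.
have mh : measurable_fun setT (fun z : measurableTypeR R * measurableTypeR R =>
    (F z.1 * k (z.1 - z.2))%:E).
  by apply/measurable_EFinP; exact: measurable_funM.
apply/(integrable12ltyP lam lam mh).
have mak : measurable_fun setT (fun v => `|k v|%:E).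
  by apply/measurable_EFinP; exact: measurableT_comp.
have -> : (\int[lam]_t \int[lam]_u `|(F t * k (t - u))%:E| =
    \int[mu]_t (`|(F t)%:E| * \int[mu]_v `|(k v)%:E|))%E.
  apply: eq_integral => t _ /=.
  rewrite -(ge0_integral_reflect t mak)//.
  rewrite -ge0_integralZl//=.
  - by apply: eq_integral => u _; rewrite normrM EFinM.
  - apply: (measurableT_comp mak); exact: measurable_funB.
have K0 : (0 <= \int[mu]_v `|(k v)%:E|)%E by apply: integral_ge0.
rewrite ge0_integralZr//; first last.
  by apply/measurable_EFinP; exact: measurableT_comp.
have /integrableP[_ fF] := iF; have /integrableP[_ fk] := ik.
by rewrite lte_mul_pinfty// ?integral_ge0// ge0_fin_numE// integral_ge0.
Qed.

Lemma integrable_opp F : mu.-integrable setT (EFin \o F) ->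
  mu.-integrable setT (EFin \o (fun t => F (- t))).
Proof.
move=> iF; have mF := integrable_measurable iF.
have maF : measurable_fun setT (fun v => `|F v|%:E).
  by apply/measurable_EFinP; exact: measurableT_comp.
apply/integrableP; split.
  by apply/measurable_EFinP; apply: (measurableT_comp mF).
have /integrableP[_ fF] := iF.
by have := ge0_integral_opp maF => -> //.
Qed.

(** The exponent is the one that makes [cut] to the power 1 - y equal to the
    kernel; it is integrable at 0 because y < al. *)
Let cut al y (L : R) : R -> R := (@powR R ^~ (- ((1 - al) / (1 - y)))) \_ `]0, L].

Let cut_ge0 al y L v : 0 <= cut al y L v.
Proof. by rewrite /cut restrictE; case: ifP => // _; exact: powR_ge0. Qed.

Let integrable_cut al y L : y < al -> al < 1 -> 0 < L ->
  mu.-integrable setT (EFin \o cut al y L).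
Proof.
move=> yal al1 L0; apply: integrable_powR_itv.
set c := (1 - al) / (1 - y).
have c1 : c < 1 by rewrite /c ltr_pdivrMr ?subr_gt0 ?(lt_trans yal)// mul1r; lra.
rewrite (_ : - c = 1 - c - 1); last by ring.
by apply: integral_powR_head; rewrite ?subr_gt0.
Qed.

Let kpow_le_cut al y L s (G : R) : 0 < y -> y < 1 -> 0 <= G -> s <= L ->
  kpow al s * G `^ y <= G + cut al y L s.
Proof.
move=> y0 y1 G0 sL; rewrite /kpow; case: ifPn => s0; last first.
  by rewrite mul0r addr_ge0.
rewrite /cut restrictE mem_setE in_itv/= s0 sL/=.
have -> : s `^ (al - 1) = (s `^ (- ((1 - al) / (1 - y)))) `^ (1 - y).
  by rewrite -powRrM mulNr divfK ?opprB// gt_eqF// subr_gt0.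
by rewrite mulrC powR_convex_le// powR_ge0.
Qed.

Let dist_lt (a b t u : R) : a < u -> t < b -> t - u <= `|b - a| + 1.
Proof.
move=> au tb; rewrite (le_trans (lerB (ltW tb) (ltW au)))//.
by rewrite (le_trans (ler_norm _))// lerDl.
Qed.

(** The case p = 1 and q = 1 / y: the condition y < al makes the kernel integrable
    to the power 1 / (1 - y) near 0, and the product of the kernel with G^y is at
    most the sum of that power and G. *)
Lemma energy_L1l al y a b f g G : 0 < y -> y < al -> al < 1 ->
  measurable_fun setT g -> mu.-integrable setT (EFin \o f) ->
  mu.-integrable setT (EFin \o G) -> (forall t, 0 <= G t) ->
  (forall t, b <= t -> f t = 0) -> (forall u, u <= a -> g u = 0) ->
  (forall t, `|g t| <= G t `^ y) ->
  mu2.-integrable setT (fun z => (f z.1 * (kpow al (z.1 - z.2) * g z.2))%:E).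
Proof.
move=> y0 yal al1 mg i_f iG G0 fb ga gG.
have mf := integrable_measurable i_f.
have y1 := lt_trans yal al1.
have ik := @integrable_cut al y (`|b - a| + 1) yal al1 (ltr_wpDl (normr_ge0 _) ltr01).
have i1 := integrable_prod_L1 (integrable_norm i_f) iG.
have i2 := integrable_conv_L1 (integrable_norm i_f) ik.
apply: (le_integrable measurableT _ _ (integrableD measurableT i1 i2)).
  by apply/measurable_EFinP; exact: measurable_energy.
move=> [t u] _ /=; rewrite lee_fin.
apply: le_trans (ler_norm _).
rewrite !normrM [`|kpow _ _|]ger0_norm ?kpow_ge0// -mulrDr.
have RHS0 : 0 <= G u + cut al y (`|b - a| + 1) (t - u) by rewrite addr_ge0.
have [bt|tb] := leP b t; first by rewrite fb// normr0 !mul0r.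
rewrite ler_wpM2l//.
have [ua|au] := leP u a; first by rewrite ga// normr0 mulr0.
apply: (@le_trans _ _ (kpow al (t - u) * G u `^ y)).
  by rewrite ler_wpM2l ?kpow_ge0.
by apply: kpow_le_cut => //; exact: dist_lt.
Qed.

(** The mirror image of [energy_L1l]. *)
Lemma energy_L1r al x a b f g F : 0 < x -> x < al -> al < 1 ->
  measurable_fun setT f -> mu.-integrable setT (EFin \o g) ->
  mu.-integrable setT (EFin \o F) -> (forall t, 0 <= F t) ->
  (forall t, b <= t -> f t = 0) -> (forall u, u <= a -> g u = 0) ->
  (forall t, `|f t| <= F t `^ x) ->
  mu2.-integrable setT (fun z => (f z.1 * (kpow al (z.1 - z.2) * g z.2))%:E).
Proof.
move=> x0 xal al1 mf ig iF F0 fb ga fF.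
have mg := integrable_measurable ig.
have x1 := lt_trans xal al1.
have ik := @integrable_cut al x (`|b - a| + 1) xal al1 (ltr_wpDl (normr_ge0 _) ltr01).
have i1 := integrable_prod_L1 iF (integrable_norm ig).
have i2 := integrable_swap (integrable_conv_L1 (integrable_norm ig) (integrable_opp ik)).
apply: (le_integrable measurableT _ _ (integrableD measurableT i1 i2)).
  by apply/measurable_EFinP; exact: measurable_energy.
move=> [t u] _ /=; rewrite lee_fin opprB.
apply: le_trans (ler_norm _).
rewrite !normrM [`|kpow _ _|]ger0_norm ?kpow_ge0//.
rewrite [F t * _]mulrC -mulrDr mulrA mulrC.
have RHS0 : 0 <= F t + cut al x (`|b - a| + 1) (t - u) by rewrite addr_ge0.
have [ua|au] := leP u a; first by rewrite ga// normr0 !mul0r.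
rewrite ler_wpM2l//.
have [bt|tb] := leP b t; first by rewrite fb// normr0 mul0r.
apply: (@le_trans _ _ (kpow al (t - u) * F t `^ x)).
  by rewrite mulrC ler_wpM2l ?kpow_ge0.
by apply: kpow_le_cut => //; exact: dist_lt.
Qed.

Lemma energy_ge1 al a b f g : 1 <= al ->
  mu.-integrable setT (EFin \o f) -> mu.-integrable setT (EFin \o g) ->
  (forall t, b <= t -> f t = 0) -> (forall u, u <= a -> g u = 0) ->
  mu2.-integrable setT (fun z => (f z.1 * (kpow al (z.1 - z.2) * g z.2))%:E).
Proof.
move=> al1 i_f ig fb ga.
have mf := integrable_measurable i_f; have mg := integrable_measurable ig.
have i1 := integrable_prod_L1 i_f ig.
apply: (le_integrable measurableT _ _ (integrableZl measurableT (kpow al (`|b - a| + 1)) i1)).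
  by apply/measurable_EFinP; exact: measurable_energy.
move=> [t u] _ /=; rewrite lee_fin !normrM ![`|kpow _ _|]ger0_norm ?kpow_ge0//.
have [bt|tb] := leP b t; first by rewrite fb// normr0 !mul0r mulr0.
have [ua|au] := leP u a; first by rewrite ga// normr0 !mulr0.
rewrite mulrCA ler_wpM2r ?mulr_ge0//.
have := dist_lt au tb; set L := `|b - a| + 1 => sL.
have L0 : 0 < L by rewrite /L ltr_wpDl.
rewrite /kpow L0; case: ifP => s0; last exact: powR_ge0.
by rewrite ge0_ler_powR ?nnegrE ?(ltW s0) ?(ltW L0)// subr_ge0.
Qed.

Variables (a b : R) (ab : a < b).

Lemma restrict_itvoo_le f t : t <= a -> (f \_ `]a, b[) t = 0.
Proof. by move=> ta; rewrite restrictE mem_setE in_itv/= ltNge ta. Qed.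

Lemma restrict_itvoo_ge f t : b <= t -> (f \_ `]a, b[) t = 0.
Proof. by move=> bt; rewrite restrictE mem_setE in_itv/= [t < b]ltNge bt andbF. Qed.

(** Adding 1 on the interval makes the majorant at least 1 there, so that its
    powers increase with the exponent: this is the inclusion of Lp spaces on a
    bounded interval. *)
Let dom p f : R -> R := fun t => `|(f \_ `]a, b[) t| `^ p + \1_(`]a, b[%classic) t.

Let dom_ge0 p f t : 0 <= dom p f t.
Proof. by rewrite addr_ge0 ?powR_ge0. Qed.

Let integrable_dom p f : 1 <= p -> in_Lp p a b f ->
  mu.-integrable setT (EFin \o dom p f).
Proof.
move=> p1 fp; have i1 := Lfun_integrable p1 fp.
have i2 := @integrable_indic_itv R a b false true.
exact: (integrableD measurableT i1 i2).
Qed.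

Let dom_le p f x t : 1 <= p -> p^-1 <= x ->
  `|(f \_ `]a, b[) t| <= dom p f t `^ x.
Proof.
move=> p1 px; have p0 : 0 < p := lt_le_trans ltr01 p1.
rewrite /dom; have [tab|tab] := boolP (t \in `]a, b[%classic); last first.
  by rewrite restrictE (negbTE tab) normr0 powR_ge0.
rewrite indicE tab restrictE tab.
have D1 : 1 <= `|f t| `^ p + true%:R by rewrite lerDr powR_ge0.
apply: le_trans (ler_powR D1 px).
have e : `|f t| = (`|f t| `^ p) `^ p^-1 by rewrite -powRrM divff ?gt_eqF// powRr1.
rewrite {1}e; apply: ge0_ler_powR; rewrite ?nnegrE ?invr_ge0 ?(ltW p0) ?powR_ge0 ?addr_ge0//.
by rewrite lerDl.
Qed.

Lemma in_Lp_measurable p f : in_Lp p a b f -> measurable_fun setT (f \_ `]a, b[).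
Proof. by move=> /andP[]; rewrite inE. Qed.

Lemma in_Lp_integrable p f : 1 <= p -> in_Lp p a b f ->
  mu.-integrable setT (EFin \o (f \_ `]a, b[)).
Proof.
move=> p1 fp.
apply: (le_integrable measurableT _ _ (integrable_dom p1 fp)).
  by apply/measurable_EFinP; exact: in_Lp_measurable fp.
move=> t _ /=; rewrite lee_fin [leRHS]ger0_norm//.
rewrite -[leRHS]powRr1//; apply: dom_le => //.
by rewrite invf_le1// (lt_le_trans ltr01).
Qed.

(** On the critical line this is [energy_critical]. Below it, both exponents are
    raised towards 1 along a segment until the line is met. On the boundary
    p = 1 or q = 1 the inequality on the exponents is strict. *)
Lemma energy_Lp al p q f g : 0 < al -> 1 <= p -> 1 <= q ->
  p^-1 + q^-1 <= 1 + al -> (p^-1 + q^-1 = 1 + al -> p != 1 /\ q != 1) ->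
  in_Lp p a b f -> in_Lp q a b g ->
  mu2.-integrable setT
    (fun z => ((f \_ `]a, b[) z.1 * (kpow al (z.1 - z.2) * (g \_ `]a, b[) z.2))%:E).
Proof.
move=> al0 p1 q1 pq pqc fp gq.
have p0 : 0 < p := lt_le_trans ltr01 p1.
have q0 : 0 < q := lt_le_trans ltr01 q1.
have i_f := in_Lp_integrable p1 fp; have ig := in_Lp_integrable q1 gq.
have fb := @restrict_itvoo_ge f; have ga := @restrict_itvoo_le g.
have mf := in_Lp_measurable fp; have mg := in_Lp_measurable gq.
have [al1|al1] := leP 1 al; first exact: energy_ge1 fb ga.
have x0 : 0 < p^-1 by rewrite invr_gt0.
have y0 : 0 < q^-1 by rewrite invr_gt0.
have iF := integrable_dom p1 fp; have iG := integrable_dom q1 gq.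
have [p_eq1|p_neq1] := eqVneq p 1.
  have yal : q^-1 < al.
    rewrite ltNge; apply/negP => aly.
    have [] : p != 1 /\ q != 1; last by rewrite p_eq1 eqxx.
    by apply: pqc; move: pq; rewrite p_eq1 invr1; lra.
  apply: (energy_L1l y0 yal al1 mg i_f iG (dom_ge0 q g) fb ga) => t.
  exact: dom_le.
have [q_eq1|q_neq1] := eqVneq q 1.
  have xal : p^-1 < al.
    rewrite ltNge; apply/negP => alx.
    have [] : p != 1 /\ q != 1; last by rewrite q_eq1 eqxx.
    by apply: pqc; move: pq; rewrite q_eq1 invr1; lra.
  apply: (energy_L1r x0 xal al1 mf ig iF (dom_ge0 p f) fb ga) => t.
  exact: dom_le.
have x1 : p^-1 < 1 by rewrite invf_lt1// lt_def p_neq1.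
have y1 : q^-1 < 1 by rewrite invf_lt1// lt_def q_neq1.
(* the point of the segment from (1/p, 1/q) to (1, 1) on the critical line *)
pose S := p^-1 + q^-1.
pose s := (1 + al - S) / (2 - S).
have S2 : 0 < 2 - S by rewrite /S; lra.
have s0 : 0 <= s by rewrite divr_ge0 ?(ltW S2)// subr_ge0.
have s1 : s < 1 by rewrite /s ltr_pdivrMr// mul1r; lra.
pose x := p^-1 + s * (1 - p^-1); pose y := q^-1 + s * (1 - q^-1).
have px : p^-1 <= x by rewrite lerDl mulr_ge0// subr_ge0 ltW.
have qy : q^-1 <= y by rewrite lerDl mulr_ge0// subr_ge0 ltW.
have x1' : x < 1.
  have : s * (1 - p^-1) < 1 * (1 - p^-1) by rewrite ltr_pM2r// subr_gt0.
  by rewrite /x; lra.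
have y1' : y < 1.
  have : s * (1 - q^-1) < 1 * (1 - q^-1) by rewrite ltr_pM2r// subr_gt0.
  by rewrite /y; lra.
have xy : x + y = 1 + al.
  have -> : x + y = S + s * (2 - S) by rewrite /x /y /S; ring.
  by rewrite /s divfK ?gt_eqF// addrC subrK.
apply: (energy_critical al0 al1 (lt_le_trans x0 px) x1' (lt_le_trans y0 qy) y1' xy
  mf mg iF iG (dom_ge0 p f) (dom_ge0 q g)) => t; exact: dom_le.
Qed.

End energy_Lp.

(** * Integer orders and the fundamental theorem *)

Section fundamental_theorem.
Context {R : realType}.
Local Notation mu := (@lebesgue_measure R).
Implicit Types (f g : R -> R) (al be t a b c : R).

Lemma fracint1E g t : measurable_fun setT g ->
  fracint 1 g t = \int[mu]_(u in `]-oo, t]) g u.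
Proof.
move=> mg; rewrite /fracint Gamma1 invr1 mul1r.
rewrite {2}/Rintegral -integral_itv_bndo_bndc; last first.
  by apply: measurable_funTS; exact/measurable_EFinP.
rewrite integral_mkcond; congr fine; apply: eq_integral => u _.
rewrite erestrictE mem_setE in_itv/= /kpow subr_gt0.
by case: ifP => _; rewrite ?mul0r// subrr powRr0 mul1r.
Qed.

Lemma fracint_le al g a t : (forall u, u <= a -> g u = 0) -> t <= a ->
  fracint al g t = 0.
Proof.
move=> ga ta; rewrite /fracint (_ : \int[mu]_u _ = 0) ?mulr0//.
rewrite /Rintegral integral0_eq// => u _.
have [ua|au] := leP u a; first by rewrite ga// mulr0.
by rewrite kpow_le0 ?mul0r// subr_le0 (le_trans ta)// ltW.
Qed.

Lemma integrable_fracint al g a c : 0 < al -> mu.-integrable setT (EFin \o g) ->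
  (forall u, u <= a -> g u = 0) ->
  mu.-integrable setT (EFin \o (fracint al g \_ `]-oo, c[)).
Proof.
move=> al0 ig ga.
have mg := integrable_measurable ig.
pose f : R -> R := \1_(`]-oo, c[%classic).
have mf : measurable_fun setT f by exact: measurable_indic.
have f1 t : `|f t| <= 1 by rewrite /f indicE; case: (_ \in _); rewrite ?normr0 ?normr1.
have fc t : c <= t -> f t = 0.
  by move=> ct; rewrite /f indicE mem_setE in_itv/= ltNge ct.
have [i1 _ _] := Fubini_adjoint (measurable_kpowB al) mf mg
  (energy_bounded_L1 al0 mf ig f1 fc ga).
apply: eq_integrable (integrableZl measurableT (Gamma al)^-1 i1) => // t _ /=.
rewrite -EFinM mulrCA restrictE /f indicE.
by case: ifP => _; rewrite ?mul1r ?mul0r.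
Qed.

(** Near t, the primitive differs by a constant from the one based at t - 1. *)
Lemma continuous_fracint1 g t : mu.-integrable setT (EFin \o g) ->
  {for t, continuous (fracint 1 g)}.
Proof.
move=> ig.
have mg := integrable_measurable ig.
have igI (i : interval R) : mu.-integrable [set` i] (EFin \o g).
  by apply: integrableS ig.
have tt1 : t - 1 <= t + 1 by rewrite lerD2l; lra.
have tin : t \in `]t - 1, t + 1[ by rewrite in_itv/=; apply/andP; split; lra.
have cP := parameterized_integral_continuous tt1 (igI _).
have lt1 : t - 1 < t + 1 by lra.
have /(continuous_within_itvP _ lt1)[/(_ t tin) ct _ _] := cP.
have -> : fracint 1 g = fun x => fracint 1 g x by [].
apply: (@cvg_trans _ ((fun x => \int[mu]_(u in `]-oo, t - 1]) g u +
   parameterized_integral mu (t - 1) x g) @ t)).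
  apply: near_eq_cvg; near=> x.
  have xt : t - 1 < x by near: x; apply: lt_nbhsr; rewrite ltrBlDr ltrDl.
  rewrite fracint1E// /parameterized_integral -Rintegral_itv_obnd_cbnd; last exact: igI.
  have := @Rintegral_itvB R g -oo%O (BRight x) (t - 1) (igI _).
  by rewrite /= => <-//; rewrite ?bnd_simp ?(ltW xt)// addrC subrK.
rewrite fracint1E//.
have -> : \int[mu]_(u in `]-oo, t]) g u = \int[mu]_(u in `]-oo, t - 1]) g u +
   parameterized_integral mu (t - 1) t g.
  rewrite /parameterized_integral -Rintegral_itv_obnd_cbnd; last exact: igI.
  have := @Rintegral_itvB R g -oo%O (BRight t) (t - 1) (igI _).
  by rewrite /= => <-//; rewrite ?bnd_simp ?lerBlDr ?lerDl// addrC subrK.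
pose C := \int[mu]_(u in `]-oo, t - 1]) g u.
have cC : (fun=> C) x @[x --> t] --> C by exact: cvg_cst.
exact: (cvgD cC ct).
Unshelve. all: end_near. Qed.

Lemma fracint1_derive_ae g : mu.-integrable setT (EFin \o g) ->
  {ae mu, forall t, derivable (fracint 1 g) t 1 /\ derive1 (fracint 1 g) t = g t}.
Proof.
move=> ig.
have mg := integrable_measurable ig.
have -> : fracint 1 g = fun t => \int[mu]_(u in `]-oo, t]) g u.
  by apply/funext => t; exact: fracint1E.
apply: FTC1Ny; last first.
  by apply: open_integrable_locally => //; exact: openT.
by move=> y; apply: integrableS ig.
Qed.

(** By the semigroup law the integral of order n + 1 is the primitive of the
    integral of order n, which is continuous for n >= 1. *)
Lemma fracint_derive g a k t : mu.-integrable setT (EFin \o g) ->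
  (forall u, u <= a -> g u = 0) ->
  let h n := fracint n%:R g in
  {for t, continuous (h k.+1)} /\
  (derivable (h k.+2) t 1 /\ derive1 (h k.+2) t = h k.+1 t).
Proof.
move=> ig ga h.
have mg := integrable_measurable ig.
have step n : h n.+2 = fun t => \int[mu]_(u in `]-oo, t]) h n.+1 u.
  apply/funext => x; rewrite -fracint1E; last exact: measurable_fracint.
  rewrite /h fracint_semigroup// ?ltr0n// -[X in X + _]/(1%:R) -natrD//.
  by apply: (integrable_kpow_ge1 _ _ ig ga); rewrite ler1n.
have inth n t' : mu.-integrable `]-oo, t'] (EFin \o h n.+1).
  have := integrable_fracint (t' + 1) (ltr0Sn R n) ig ga.
  move=> /(@integrable_restrictT _ `]-oo, t' + 1[ _ (measurable_itv _)).
  apply: integrableS => // u /=; rewrite !in_itv/= => /le_lt_trans; apply.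
  by rewrite ltrDl.
have FTC n t' (ct : {for t', continuous (h n.+1)}) :
    derivable (fun x : R => \int[mu]_(u in `]-oo, x]) h n.+1 u) t' 1 /\
    derive1 (fun x : R => \int[mu]_(u in `]-oo, x]) h n.+1 u) t' = h n.+1 t'.
  have tt1 : t' < t' + 1 by rewrite ltrDl.
  exact: (@continuous_FTC1 R (h n.+1) -oo%O t' (t' + 1) tt1 (inth n (t' + 1)) (ltNyr _) ct).
elim: k t => [|k IH] t.
- have ct : {for t, continuous (h 1)} by exact: continuous_fracint1.
  split; first exact: ct.
  rewrite step.
  exact: (FTC _ t ct).
- have [_ [dt _]] := IH t.
  have ct : {for t, continuous (h k.+2)}.
    by apply: differentiable_continuous; apply/derivable1_diffP.
  split; first exact: ct.
  rewrite step.
  exact: (FTC _ t ct).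
Qed.

End fundamental_theorem.

(** * Left derivatives invert left integrals *)

Section left_operators.
Context {R : realType}.
Local Notation mu := (@lebesgue_measure R).
Let lam : {sigma_finite_measure set (measurableTypeR R) -> \bar R} := mu.
Implicit Types (f g psi : R -> R) (al be t a b c : R).

(** Any b beyond t may serve to truncate g, so one truncation represents the
    operator at all points of the interval. *)
Lemma RLint_leftE al a b g t : t <= b ->
  RLint_left al a g t = fracint al (g \_ `]a, b[) t.
Proof.
move=> tb; rewrite /RLint_left /fracint Rintegral_mkcond; congr (_ * _).
apply: eq_Rintegral => u _; rewrite !restrictE !mem_setE !in_itv/= /kpow subr_gt0.
have [au|ua] := ltP a u; last by rewrite mulr0.
have [ut|tu] := ltP u t; last by rewrite mul0r.
by rewrite (lt_le_trans ut tb).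
Qed.

Lemma RLint_rightE al a b g t : a <= t ->
  RLint_right al b g t =
  (Gamma al)^-1 * \int[mu]_u (kpow al (u - t) * (g \_ `]a, b[) u).
Proof.
move=> at_; rewrite /RLint_right Rintegral_mkcond; congr (_ * _).
apply: eq_Rintegral => u _; rewrite !restrictE !mem_setE !in_itv/= /kpow subr_gt0.
have [tu|ut] := ltP t u; last by rewrite mul0r.
by rewrite (le_lt_trans at_ tu)/=; case: ifP; rewrite ?mulr0.
Qed.

Lemma frac_order_gt al : 0 < (frac_order al)%:R - al.
Proof. by rewrite subr_gt0 truncnS_gt. Qed.

Lemma eq_derive1n_itvoo n f g a b : {in `]a, b[, f =1 g} ->
  {in `]a, b[, derive1n n f =1 derive1n n g}.
Proof.
move=> fg; elim: n => [//|n IH] t tab.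
rewrite !derive1nS !derive1E; apply: near_eq_derive.
have : \forall s \near t, s \in `]a, b[ by exact: near_in_itvoo.
by apply: filterS => s; exact: IH.
Qed.

Lemma kernel_fracint al be a b s G : s <= b ->
  (forall u, u <= a -> G u = 0) ->
  \int[mu]_(u in `]a, s[) ((s - u) `^ (be - 1) * G u) =
  \int[mu]_u (kpow be (s - u) * G u).
Proof.
move=> sb Ga; rewrite Rintegral_mkcond; apply: eq_Rintegral => u _.
rewrite restrictE mem_setE in_itv/= /kpow subr_gt0.
have [au|ua] := ltP a u; last by rewrite Ga// !mulr0.
by rewrite /=; case: ifP; rewrite ?mul0r.
Qed.

(** Applied to a fractional integral of order al, the derivative of order al
    differentiates n times the iterated integral of order n. *)
Lemma RLder_left_RLint_left al a b psi g : 0 < al ->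
  mu.-integrable setT (EFin \o (psi \_ `]a, b[)) ->
  g = RLint_left al a psi %[ae mu in `]a, b[%classic] ->
  RLder_left al a g = psi %[ae mu in `]a, b[%classic].
Proof.
pose psi0 := psi \_ `]a, b[; move=> al0 ipsi gE; rewrite -[psi \_ _]/psi0 in ipsi.
have mpsi := integrable_measurable ipsi.
have psi0a u : u <= a -> psi0 u = 0 by move=> ua; exact: restrict_itvoo_le.
set n := frac_order al; pose m := n.-1.
have nal := frac_order_gt al.
pose G := fracint al psi0.
have mG : measurable_fun setT G by exact: measurable_fracint.
have Ga u : u <= a -> G u = 0 by move=> ua; exact: fracint_le psi0a ua.
pose J s := \int[mu]_(tau in `]a, s[) ((s - tau) `^ (n%:R - 1 - al) * g tau).
(* By the semigroup law the integral to be differentiated is the n-fold primitive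
   of psi, even though g is the integral of psi only almost everywhere. *)
have JE : {in `]a, b[, J =1 fun s => Gamma (n%:R - al) * fracint n%:R psi0 s}.
  move=> s; rewrite in_itv/= => /andP[as_ sb].
  have -> : fracint n%:R psi0 s = fracint (n%:R - al) G s.
    rewrite /G fracint_semigroup ?subrK//.
    by apply: (integrable_kpow_ge1 _ _ ipsi psi0a); rewrite ler1n.
  rewrite /fracint mulVKf ?gt_eqF ?Gamma_gt0// -(@kernel_fracint al _ a b s G (ltW sb) Ga).
  apply: (@ae_eq_Rintegral _ (measurableTypeR R) R lam).
  - exact: measurable_itv.
  - apply: measurable_funTS; apply: measurable_funM => //.
    by apply: (measurableT_comp (measurable_powR _)); exact: measurable_funB.
  - apply: lebesgue_aeS gE => u /= gu; rewrite in_itv/= => /andP[au us].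
    rewrite gu; last by rewrite in_itv/= au (lt_trans us).
    rewrite (@RLint_leftE _ _ b) ?(ltW (lt_trans us sb))//.
    by congr (_ `^ _ * _); ring.
have dJ k : (k < n)%N -> {in `]a, b[, derive1n k J =1
    fun s => Gamma (n%:R - al) * fracint (n - k)%:R psi0 s}.
  elim: k => [_|k IH kn] t tab; first by rewrite subn0; exact: JE.
  have [j nkj] : exists j, (n - k = j.+2)%N.
    by exists (n - k).-2; move: kn; rewrite -subn_gt0 subnS; case: (n - k)%N => [//|[]].
  have -> : (n - k.+1 = j.+1)%N by rewrite subnS nkj.
  have [_ [dh eh]] := fracint_derive j t ipsi psi0a.
  rewrite derive1nS; have := @eq_derive1n_itvoo 1 _ _ _ _ (IH (ltnW kn)) t tab.
  by rewrite /= nkj => ->; rewrite derive1Ml// eh.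
rewrite /RLder_left -/n.
apply: lebesgue_aeS (fracint1_derive_ae ipsi) => t [dt et] tab.
(* n - 1 derivatives are taken everywhere, the last one almost everywhere. *)
have nE : n = m.+1 by [].
have n1 : (n - m = 1)%N by rewrite nE subSnn.
have := @eq_derive1n_itvoo 1 _ _ _ _ (dJ m (ltnSn m)) t tab.
rewrite /= -derive1nS -nE n1 derive1Ml// et /psi0 restrictE mem_set// => ->.
by rewrite mulKf // gt_eqF ?Gamma_gt0.
Qed.

End left_operators.

(** * Reflection of the line *)

Section reflection.
Context {R : realType}.
Local Notation mu := (@lebesgue_measure R).
Let lam : {sigma_finite_measure set (measurableTypeR R) -> \bar R} := mu.
Implicit Types (f g : R -> R) (al t a b c : R).

(** The derivative is a limit with a default value, which is 0, so the rules below
    hold at points where the function has no derivative, too. *)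
Lemma lim_not_cvg (F : set_system R) : ~ cvg F -> lim F = 0.
Proof. by move=> dF; rewrite /lim; apply: getPN => l Fl; apply: dF; apply/cvg_ex; exists l. Qed.

Lemma lim_scale (D : R -> R) c : c != 0 ->
  lim (c * D h @[h --> (0 : R)^']) = c * lim (D h @[h --> (0 : R)^']).
Proof.
move=> c0; have [cD|dD] := pselect (cvg (D h @[h --> (0 : R)^'])).
  by apply: (cvg_lim (@Rhausdorff R)); apply: cvgM cD; exact: cvg_cst.
rewrite (lim_not_cvg dD) mulr0 lim_not_cvg// => /cvg_ex[l cl]; apply: dD.
apply/cvg_ex; exists (c^-1 * l).
have -> : D = fun h => c^-1 * (c * D h) by apply/funext => h; rewrite mulKf.
by apply: cvgM cl; exact: cvg_cst.
Qed.

Lemma cvg_dnbhs0N : (fun h : R => - h) @ 0^' --> (0 : R)^'.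
Proof.
move=> A [e e0 eA]; exists e => // h he h0; apply: eA; last by rewrite oppr_eq0.
by move: he; rewrite /= !sub0r !normrN.
Qed.

Lemma lim_flip (D : R -> R) : lim (D (- h) @[h --> (0 : R)^']) = lim (D h @[h --> (0 : R)^']).
Proof.
have flip (G : R -> R) (l : R) : G h @[h --> (0 : R)^'] --> l -> G (- h) @[h --> (0 : R)^'] --> l.
  by move=> Gl; apply: (cvg_comp _ _ cvg_dnbhs0N Gl).
have [cD|dD] := pselect (cvg (D h @[h --> (0 : R)^'])).
  by apply: (cvg_lim (@Rhausdorff R)); apply: flip; exact: cD.
rewrite (lim_not_cvg dD) lim_not_cvg// => /cvg_ex[l cl]; apply: dD.
apply/cvg_ex; exists l.
have := flip (fun h => D (- h)) l cl; apply: cvg_trans; apply: near_eq_cvg.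
by apply: nearW => h /=; rewrite opprK.
Qed.

Lemma derive1_scale_opp c f t : c != 0 ->
  derive1 (fun s => c * f (- s)) t = - c * derive1 f (- t).
Proof.
move=> c0; have nc0 : - c != 0 by rewrite oppr_eq0.
rewrite /derive1 -(lim_scale _ nc0) -[RHS]lim_flip.
suff -> : (fun h : R => h^-1 *: (c * f (- (h + t)) - c * f (- t))) =
  (fun h => - c * ((- h)^-1 *: (f (- h + - t) - f (- t)))) by [].
by apply/funext => h; rewrite /GRing.scale/= opprD invrN; ring.
Qed.

Lemma derive1n_opp n f t :
  derive1n n (fun s => f (- s)) t = (-1) ^+ n * derive1n n f (- t).
Proof.
elim: n t => [|n IH] t; first by rewrite expr0 mul1r.
rewrite !derive1nS.
have -> : derive1n n (fun s => f (- s)) = fun s => (-1) ^+ n * derive1n n f (- s).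
  by apply/funext => s; exact: IH.
by rewrite derive1_scale_opp ?signr_eq0// exprS mulN1r.
Qed.

Import HBNNSimple.

Let ge0_integral_reflect_le (f : R -> \bar R) : (forall t, 0 <= f t)%E ->
  (\int[mu]_t f t <= \int[mu]_t f (- t)%R)%E.
Proof.
move=> f0; rewrite [leLHS]ge0_integralTE//; apply: ge_ereal_sup => _ [h /= hf <-].
have -> : sintegral mu h = (\int[mu]_t (h t)%:E)%E.
  by rewrite integral_nnsfun// patch_setT.
have mh : measurable_fun setT (fun t => (h t)%:E).
  apply/measurable_EFinP.
  by have mh := @measurable_funP _ _ (measurableTypeR R) _ setT h.
have h0 t : (0 <= (h t)%:E)%E by rewrite lee_fin.
rewrite -(ge0_integral_opp mh h0) !ge0_integralTE//.
by apply: le_ereal_sup => _ [k /= kh <-]; exists k => //= t; exact: le_trans (kh t) (hf _).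
Qed.

(** The reflection preserves simple functions and their integrals, hence the
    suprema that define the integrals of arbitrary functions. *)
Lemma integral_reflect (f : R -> \bar R) : (\int[mu]_t f (- t)%R = \int[mu]_t f t)%E.
Proof.
have ge0 (g : R -> \bar R) : (forall t, 0 <= g t)%E -> (\int[mu]_t g (- t)%R = \int[mu]_t g t)%E.
  move=> g0; apply/eqP; rewrite eq_le ge0_integral_reflect_le// andbT.
  apply: le_trans (@ge0_integral_reflect_le (fun t => g (- t)) _) _ => //.
  by under eq_integral do rewrite opprK.
rewrite integralE [RHS]integralE -[in RHS](ge0 f^\+%E) -?[in RHS](ge0 f^\-%E)//.
congr (_ - _)%E.
- by apply: eq_integral => t _; rewrite !funeposE.
- by apply: eq_integral => t _; rewrite !funenegE.
Qed.

(** Opposite signs exchange the positive and negative parts, and the value 0 given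
    to infinite integrals is its own opposite. *)
Lemma RintegralN_nomeas (D : set R) f :
  \int[mu]_(t in D) (- f t) = - \int[mu]_(t in D) f t.
Proof.
rewrite /Rintegral integralE [in RHS]integralE.
have -> : (\int[mu]_(t in D) ((fun t => (- f t)%:E)^\+ t) =
    \int[mu]_(t in D) ((fun t => (f t)%:E)^\- t))%E.
  by apply: eq_integral => t _; rewrite funeposE funenegE.
have -> : (\int[mu]_(t in D) ((fun t => (- f t)%:E)^\- t) =
    \int[mu]_(t in D) ((fun t => (f t)%:E)^\+ t))%E.
  by apply: eq_integral => t _; rewrite funeposE funenegE /= opprK.
move: (integral _ _ _) (integral _ _ _) => [x| |] [y| |] //=; rewrite ?oppr0//.
by rewrite opprB.
Qed.

Lemma Rintegral_reflect_itvoo a b f :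
  \int[mu]_(t in `]a, b[) f t = \int[mu]_(t in `](- b), (- a)[) f (- t).
Proof.
rewrite /Rintegral integral_mkcond -integral_reflect [in RHS]integral_mkcond.
congr fine; apply: eq_integral => t _; rewrite !erestrictE !mem_setE !in_itv/=.
by rewrite ltrNr ltrNl andbC.
Qed.

Lemma RLint_right_opp al b f t :
  RLint_right al b f t = RLint_left al (- b) (fun s => f (- s)) (- t).
Proof.
rewrite /RLint_right /RLint_left (Rintegral_reflect_itvoo t b); congr (_ * _).
by apply: eq_Rintegral => s _; congr (_ `^ _ * _); ring.
Qed.

Lemma RLder_right_opp al b f t :
  RLder_right al b f t = RLder_left al (- b) (fun s => f (- s)) (- t).
Proof.
rewrite /RLder_right /RLder_left; congr (_ * _); set n := frac_order al.
pose F s := \int[mu]_(u in `](- b), s[) ((s - u) `^ (n%:R - 1 - al) * f (- u)).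
have -> : (fun s => \int[mu]_(u in `]s, b[) ((u - s) `^ (n%:R - 1 - al) * f u)) =
    fun s => F (- s).
  apply/funext => s; rewrite Rintegral_reflect_itvoo.
  by apply: eq_Rintegral => u _; congr (_ `^ _ * _); ring.
by rewrite (derive1n_opp n F) signrMK.
Qed.

Lemma Cder_right_opp al b f t :
  Cder_right al b f t = Cder_left al (- b) (fun s => f (- s)) (- t).
Proof.
rewrite /Cder_right /Cder_left; set n := frac_order al.
rewrite Rintegral_reflect_itvoo [_ / _]mulrC -mulrA; congr (_ * _).
have E s := derive1n_opp n f s.
have [sg|sg] : (-1) ^+ n = 1 :> R \/ (-1) ^+ n = -1 :> R.
  by rewrite -signr_odd; case: (odd n); [right; rewrite expr1|left; rewrite expr0].
- rewrite sg mul1r; apply: eq_Rintegral => s _; rewrite E sg mul1r.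
  by congr (_ `^ _ * _); ring.
- rewrite sg mulN1r -RintegralN_nomeas; apply: eq_Rintegral => s _.
  by rewrite E sg mulN1r mulrN; congr (- (_ `^ _ * _)); ring.
Qed.

Lemma ae_reflect (P : R -> Prop) :
  {ae mu, forall t, P t} -> {ae mu, forall t, P (- t)}.
Proof.
move=> [N [mN N0 sN]]; exists (-%R @^-1` N); split.
- have mo : measurable_fun setT (fun x : measurableTypeR R => (- x : measurableTypeR R)).
    exact: measurable_funN.
  by rewrite -[X in measurable X]setTI; exact: (mo measurableT N mN).
- by rewrite -[RHS]N0; exact: lebesgue_measureN.
- by move=> t /= nP; exact: sN.
Qed.

End reflection.

(** * Absolute continuity of the variation *)

Section absolute_continuity_of_the_variation.
Context {R : realType}.
Implicit Types (f : R -> R) (a b e d x y : R) (s : seq (R * R)).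

Definition apart (p q : R * R) := (p.2 <= q.1) || (q.2 <= p.1).

Definition interval_family a b s :=
  all (fun p => [&& a <= p.1, p.1 <= p.2 & p.2 <= b]) s && pairwise apart s.

Definition ac_modulus a b f e d := forall s, interval_family a b s ->
  \sum_(p <- s) (p.2 - p.1) < d -> \sum_(p <- s) `|f p.2 - f p.1| <= e.

(** Lists of pairs are easier to split and concatenate than families indexed by
    ordinals. *)
Lemma abs_continuous_modulus a b f e : abs_continuous a b f -> 0 < e ->
  exists2 d, 0 < d & ac_modulus a b f e d.
Proof.
move=> ac e0; have [d d0 H] := ac e e0; exists d => // s /andP[/allP sab sP] sd.
pose u i := (tnth (in_tuple s) i).1; pose v i := (tnth (in_tuple s) i).2.
have -> : \sum_(p <- s) `|f p.2 - f p.1| = \sum_(i < size s) `|f (v i) - f (u i)|.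
  by rewrite big_tnth.
apply/ltW/H.
- by move=> i; have /sab/and3P[] := mem_tnth i (in_tuple s).
- apply/trivIsetP => i j _ _ ij.
  wlog lt_ij : i j ij / (i < j)%N.
    move=> W; have := ij; rewrite -val_eqE neq_ltn => /orP[ltij|ltji]; first exact: W.
    by rewrite setIC; apply: W => //; rewrite eq_sym.
  have : apart (tnth (in_tuple s) i) (tnth (in_tuple s) j).
    rewrite !(tnth_nth (0, 0)); apply: (pairwiseP (0, 0) sP) => //; exact: ltn_ord.
  move=> apij; apply/seteqP; split => // x /= []; rewrite !in_itv/=.
  rewrite /u /v => /andP[x1 x2] /andP[x3 x4].
  case/orP: apij => h.
    by have := lt_trans (lt_le_trans x2 h) x3; rewrite ltxx.
  by have := lt_trans (lt_le_trans x4 h) x1; rewrite ltxx.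
- by move: sd; rewrite big_tnth.
Qed.

Let Fixpoint steps x (l : seq R) : seq (R * R) :=
  if l is y :: l' then (x, y) :: steps y l' else [::].

Let variation_steps x y f l : itv_partition x y l ->
  variation x y f l = \sum_(p <- steps x l) `|f p.2 - f p.1|.
Proof.
move=> xyl; rewrite (variation_zip f xyl) => {xyl}.
elim: l x => [|z l IH] x /=; first by rewrite !big_nil.
by rewrite !big_cons IH.
Qed.

Let sum_steps x l : \sum_(p <- steps x l) (p.2 - p.1) = last x l - x.
Proof.
elim: l x => [|y l IH] x /=; first by rewrite big_nil subrr.
by rewrite big_cons IH /=; ring.
Qed.

Let steps_family x l : path <%O x l -> interval_family x (last x l) (steps x l).
Proof.
elim: l x => [//|y l IH] x /= /andP[xy yl].
have /andP[al pw] := IH y yl.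
have yl' : y <= last y l.
  have : itv_partition y (last y l) l by split.
  exact: itv_partition_le.
rewrite /interval_family /= lexx (ltW xy) yl' pw !andbT /=; apply/andP; split.
  apply/allP => p /(allP al)/and3P[p1 -> ->].
  by rewrite (le_trans (ltW xy) p1).
by apply/allP => p /(allP al)/and3P[p1 _ _]; rewrite /apart /= p1.
Qed.

Let apartC p q : apart p q = apart q p.
Proof. by rewrite /apart orbC. Qed.

Let apart_sub p q r : q.1 <= r.1 -> r.2 <= q.2 -> apart p q -> apart p r.
Proof.
move=> qr rq /orP[pq|qp]; apply/orP; [left|right].
  exact: le_trans pq qr.
exact: le_trans rq qp.
Qed.

(** Refining each interval by a partition gives another family of the same total
    length, so the variation inherits the modulus. The list s2 collects the
    intervals that have been subdivided, in the induction on s1. *)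
Lemma total_variation_modulus a b f e d : ac_modulus a b f e d ->
  forall s1 s2, interval_family a b (s1 ++ s2) ->
  \sum_(p <- s1 ++ s2) (p.2 - p.1) < d ->
  (\sum_(p <- s1) total_variation p.1 p.2 f +
    (\sum_(p <- s2) `|f p.2 - f p.1|)%:E <= e%:E)%E.
Proof.
move=> H; elim=> [|[x y] s1 IH] s2 fs sd.
  by rewrite big_nil add0e lee_fin; exact: H.
rewrite big_cons /=.
have /andP[/= /andP[/and3P[ax xy yb] al] /andP[pxy pw]] := fs.
have len0 : 0 <= y - x by rewrite subr_ge0.
have len p : p \in s1 ++ s2 -> 0 <= p.2 - p.1.
  by move=> /(allP al)/and3P[_ h _]; rewrite subr_ge0.
have fam' : interval_family a b (s1 ++ s2) by rewrite /interval_family al pw.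
have sd' : \sum_(p <- s1 ++ s2) (p.2 - p.1) < d.
  by apply: le_lt_trans sd; rewrite big_cons /= lerDr.
have c_le := IH s2 fam' sd'.
set c1 := (\sum_(p <- s1) _)%E in c_le *.
have c1_ge0 : (0 <= c1)%E.
  rewrite /c1 big_seq; apply: sume_ge0 => p ps.
  by apply: total_variation_ge0; rewrite -subr_ge0 len// mem_cat ps.
have c1_fin : c1 \is a fin_num.
  rewrite ge0_fin_numE//; apply: (@le_lt_trans _ _ e%:E); last by rewrite ltry.
  by apply: le_trans c_le; rewrite leeDl// lee_fin sumr_ge0.
rewrite -addeA -leeBrDr; last by rewrite fin_numD c1_fin.
apply: ge_ereal_sup => _ [v [l xyl <-] <-].
rewrite leeBrDr; last by rewrite fin_numD c1_fin.
rewrite (variation_steps f xyl) addeCA -EFinD -big_cat /=.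
have [xl /eqP ly] := xyl.
have /andP[stal stpw] := steps_family xl.
apply: IH.
- rewrite /interval_family !all_cat !pairwise_cat.
  move: al pw pxy; rewrite !all_cat pairwise_cat => /andP[-> ->] /and3P[rel12 -> ->].
  move=> /andP[px1 px2]; rewrite stpw !andbT /=.
  have st_sub p : p \in steps x l -> x <= p.1 /\ p.2 <= y.
    by move=> /(allP stal)/and3P[h1 _ h2]; rewrite -ly.
  apply/and3P; split.
  + apply/allP => p /(allP stal)/and3P[h1 -> h2].
    by rewrite (le_trans ax h1)/= (le_trans h2)// ly.
  + rewrite allrel_catr rel12 andbT; apply/allrelP => p q p1 /st_sub[q1 q2].
    by apply: (@apart_sub _ (x, y)) => //; rewrite apartC; exact: (allP px1).
  + apply/allrelP => p q /st_sub[p1 p2] q2; rewrite apartC.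
    by apply: (@apart_sub _ (x, y)) => //; rewrite apartC; exact: (allP px2).
- rewrite !big_cat /= sum_steps ly addrCA -big_cat /=.
  by move: sd; rewrite big_cons.
Qed.

End absolute_continuity_of_the_variation.

(** * Densities of absolutely continuous functions *)

Section density.
Context {R : realType}.
Local Notation mu := (@lebesgue_measure R).
Variables (a b : R) (Phi : cumulative R R).
Hypothesis ab : a < b.
Let nu : {measure set (measurableTypeR R) -> \bar R} := lebesgue_stieltjes_measure Phi.

Lemma stieltjes_itvoc x y : x <= y -> nu `]x, y]%classic = (Phi y - Phi x)%:E.
Proof.
move=> xy; rewrite /nu/= /lebesgue_stieltjes_measure /measure_extension.
rewrite measurable_mu_extE/=; last exact: is_ocitv.
by rewrite wlength_itv_bnd.
Qed.

Let node N k : R := a + k%:R * ((b - a) / N.+1%:R).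

Let cell N k : set R := `]node N k, node N k.+1]%classic.

Let step_gt0 N : 0 < (b - a) / N.+1%:R.
Proof. by rewrite divr_gt0// subr_gt0. Qed.

Let node_le N j k : (j <= k)%N -> node N j <= node N k.
Proof. by move=> jk; rewrite /node lerD2l ler_wpM2r ?(ltW (step_gt0 N))// ler_nat. Qed.

Let node0 N : node N 0 = a.
Proof. by rewrite /node mul0r addr0. Qed.

Let nodeN N : node N N.+1 = b.
Proof. by rewrite /node mulrC divfK ?pnatr_eq0// addrC subrK. Qed.

(** The cell of x is found as the first one that ends at or after x. *)
Let in_cell N x : a < x <= b -> exists2 k, (k < N.+1)%N & cell N k x.
Proof.
move=> /andP[ax xb].
have ex : exists k, x <= node N k.+1 by exists N; rewrite nodeN.
have := ex_minnP ex; case=> k xk kmin; exists k.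
  by rewrite ltnS; apply: kmin; rewrite nodeN.
rewrite /cell /= in_itv/= xk andbT; case: k xk kmin => [|k] xk kmin; first by rewrite node0.
by rewrite ltNge; apply/negP => /kmin; rewrite ltnn.
Qed.

Let trivIset_cell N : trivIset setT (fun k : 'I_N.+1 => cell N k).
Proof.
apply/trivIsetP => i j _ _ ij.
wlog lt_ij : i j ij / (i < j)%N.
  move=> W; have := ij; rewrite -val_eqE neq_ltn => /orP[ltij|ltji]; first exact: W.
  by rewrite setIC; apply: W => //; rewrite eq_sym.
apply/seteqP; split => // x /= []; rewrite /cell /= !in_itv/= => /andP[_ x1] /andP[x2 _].
by have := lt_le_trans x2 (le_trans x1 (node_le N lt_ij)); rewrite ltxx.
Qed.

Variables (U : set R) (e d : R).
Hypothesis oU : open U.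
Hypothesis Ud : (mu U < d%:E)%E.
Hypothesis Phi_ac : ac_modulus a b Phi e d.

Let inner N : set R := \big[setU/set0]_(k < N.+1 | `[< cell N k `<=` U >]) cell N k.

Let measurable_inner N : measurable (inner N).
Proof. by apply: bigsetU_measurable => k _; exact: measurable_itv. Qed.

Let inner_sub N : inner N `<=` U.
Proof.
rewrite /inner; apply: (big_ind (fun A => A `<=` U)) => //.
- by move=> A B AU BU; rewrite subUset.
- by move=> k /asboolP.
Qed.

Let cells N : seq (R * R) :=
  [seq (node N k, node N k.+1) | k <- iota 0 N.+1 & `[< cell N k `<=` U >]].

Let sum_cells N (F : R -> R -> R) :
  \sum_(p <- cells N) F p.1 p.2 =
  \sum_(k < N.+1 | `[< cell N k `<=` U >]) F (node N k) (node N k.+1).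
Proof.
rewrite big_map big_filter -[iota _ _]/(index_iota 0 N.+1).
by rewrite (big_mkord (fun k => `[< cell N k `<=` U >])).
Qed.

Let cells_family N : interval_family a b (cells N).
Proof.
apply/andP; split.
  apply/allP => _ /mapP[k + ->]; rewrite mem_filter mem_iota => /andP[_ /andP[_ kN]] /=.
  have ak : a <= node N k by rewrite -[leLHS](node0 N) node_le.
  have kb : node N k.+1 <= b by rewrite -[leRHS](nodeN N) node_le.
  by rewrite ak kb node_le.
rewrite pairwise_map; apply/pairwise_filter.
have := iota_ltn_sorted 0 N.+1; rewrite (sorted_pairwise ltn_trans).
by apply: sub_pairwise => j k jk; rewrite /= /apart node_le.
Qed.

(** The cells contained in U are non-overlapping and have total length at most
    the measure of U. *)
Let nu_inner N : (nu (inner N) <= e%:E)%E.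
Proof.
have Ed : \sum_(p <- cells N) (p.2 - p.1) < d.
  rewrite (sum_cells N (fun x y => y - x)) -lte_fin; apply: le_lt_trans Ud.
  apply: le_trans (_ : mu (inner N) <= _)%E; last first.
    by apply: le_measure; rewrite ?inE; [exact: measurable_inner|exact: open_measurable|exact: inner_sub].
  rewrite /inner measure_bigsetU_ord//; last by move=> k; exact: measurable_itv.
  rewrite -sumEFin; apply: lee_sum => k _.
  have <- : lebesgue_measure (cell N k) = (node N k.+1 - node N k)%:E; last exact: lexx.
  rewrite /cell lebesgue_measure_itv/= lte_fin EFinB; case: ifPn => //.
  rewrite -leNgt => h; have -> : node N k.+1 = node N k by apply/le_anti; rewrite h node_le.
  by rewrite subee.
have := Phi_ac (cells_family N) Ed.
rewrite (sum_cells N (fun x y => `|Phi y - Phi x|)) -lee_fin; apply: le_trans.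
rewrite /inner measure_bigsetU_ord//; last by move=> k; exact: measurable_itv.
rewrite -sumEFin; apply: lee_sum => k _.
apply: (@le_trans _ _ (nu (cell N k))); first exact: lexx.
by rewrite /cell stieltjes_itvoc ?node_le// lee_fin ler_norm.
Qed.

(** U is the lower limit of the unions of the cells contained in it, along the
    subdivisions of the interval into equal cells. *)
Lemma stieltjes_open_le : (nu (U `&` `]a, b]) <= e%:E)%E.
Proof.
pose V n := \bigcap_m inner (n + m)%N.
have mV n : measurable (V n) by apply: bigcapT_measurable => m; exact: measurable_inner.
have ndV : nondecreasing_seq V.
  apply/nondecreasing_seqP => n; apply/subsetPset => x Vx m _.
  by have := Vx m.+1 I; rewrite addnS.
have UV : U `&` `]a, b] `<=` \bigcup_n V n.
  move=> x [Ux]; rewrite /= in_itv/= => xab.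
  have [r /= r0 rU] : \near x, U x by apply: open_nbhs_nbhs; split.
  exists (Num.truncn ((b - a) / r)) => // m _.
  set N := (_ + m)%N.
  have NE : (b - a) / N.+1%:R < r.
    rewrite ltr_pdivrMr// mulrC -ltr_pdivrMr//; apply: (lt_le_trans (truncnS_gt _)).
    by rewrite ler_nat ltnS leq_addr.
  have [k kN xk] := in_cell N xab.
  rewrite /inner (bigD1 (Ordinal kN)) /=; first by left.
  apply/asboolP => y yk; apply: rU; rewrite /ball /=.
  move: xk yk; rewrite /cell /= !in_itv/= /node; set h := (b - a) / N.+1%:R in NE *; rewrite -[k.+1%:R]natr1 mulrDl mul1r.
  move=> /andP[x1 x2] /andP[y1 y2]; rewrite ltr_norml; apply/andP; split; lra.
apply: (@le_trans _ _ (nu (\bigcup_n V n))).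
  apply: le_measure; rewrite ?inE; last exact: UV.
    by apply: measurableI; [exact: open_measurable|exact: measurable_itv].
  exact: bigcupT_measurable.
have cv : nu (V n) @[n --> \oo] --> nu (\bigcup_n V n).
  by apply: nondecreasing_cvg_mu => //; exact: bigcupT_measurable.
rewrite -(cvg_lim _ cv)//; apply: lime_le; first by apply/cvg_ex; eexists; exact: cv.
near=> n; apply: le_trans (nu_inner n).
apply: le_measure; rewrite ?inE; [exact: mV|exact: measurable_inner|].
by move=> x /(_ 0%N I); rewrite addn0.
Unshelve. all: end_near. Qed.

End density.

Section monotone_density.
Context {R : realType}.
Local Notation mu := (@lebesgue_measure R).
Variables (a b : R) (Phi : cumulative R R).
Hypothesis ab : a < b.
Hypothesis Phi_ac : forall e, 0 < e -> exists2 d, 0 < d & ac_modulus a b Phi e d.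
Let nu : {measure set (measurableTypeR R) -> \bar R} := lebesgue_stieltjes_measure Phi.

Let nu_null (A : set R) : measurable A -> mu A = 0%E -> nu (A `&` `]a, b]) = 0%E.
Proof.
move=> mA A0; apply/eqP; rewrite -measure_le0; apply/lee_addgt0Pr => e e0.
rewrite add0e; have [d d0 Hd] := Phi_ac e0.
have Afin : (mu A < +oo)%E by rewrite A0 ltry.
have [U [oU AU UA]] := lebesgue_regularity_outer mA Afin d0.
have Ud : (mu U < d%:E)%E.
  have mU : measurable (U : set (measurableTypeR R)) by exact: open_measurable.
  pose lam : {measure set (measurableTypeR R) -> \bar R} := mu.
  have UA0 : lam (U `&` A) = 0%E.
    by apply: (@subset_measure0 _ _ _ lam _ A) => //; exact: measurableI.
  have -> : mu U = lam (U `\` A).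
    by rewrite -[mu U]/(lam U) (measureDI lam mU mA) [X in (_ + X)%E]UA0 adde0.
  exact: UA.
apply: le_trans (stieltjes_open_le ab oU Ud Hd).
apply: le_measure; rewrite ?inE.
- by apply: measurableI => //; exact: measurable_itv.
- by apply: measurableI; [exact: open_measurable|exact: measurable_itv].
- by move=> x [/AU].
Qed.

(** By outer regularity, a Lebesgue null set is contained in open sets of
    arbitrarily small measure, so it is null for the Stieltjes measure; the
    density is then the Radon-Nikodym derivative. *)
Lemma stieltjes_density : exists2 h : R -> R, mu.-integrable setT (EFin \o h) &
  forall t, a <= t <= b -> Phi t - Phi a = \int[mu]_(x in `]a, t]) h x.
Proof.
have mab : measurable (`]a, b]%classic : set (measurableTypeR R)) by exact: measurable_itv.
have nufin : (nu `]a, b]%classic < +oo)%E by rewrite /nu stieltjes_itvoc ?(ltW ab)// ltry.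
pose nu' : {finite_measure set (measurableTypeR R) -> \bar R} := mfrestr mab nufin.
pose lam : {sigma_finite_measure set (measurableTypeR R) -> \bar R} := mu.
have dom : nu' `<< lam.
  by apply/null_content_dominatesP => A mA A0; exact: nu_null.
have [f [f0 ffin fint fE]] := radon_nikodym_sigma_finite dom.
exists (fine \o f).
  have -> : EFin \o (fine \o f) = f by apply/funext => x /=; rewrite fineK.
  exact: fint.
move=> t /andP[at' tb]; rewrite /Rintegral.
have -> : (\int[mu]_(x in `]a, t]) (EFin ((fine \o f) x)) = \int[lam]_(x in `]a, t]) f x)%E.
  by apply: eq_integral => x _ /=; rewrite fineK.
rewrite -fE; last exact: measurable_itv.
rewrite /nu' /= /mfrestr /mrestr.
have -> : `]a, t]%classic `&` `]a, b]%classic = `]a, t]%classic.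
  apply/seteqP; split => [x []//|x /= xt]; split => //.
  by move: xt; rewrite !in_itv/= => /andP[-> /le_trans->].
by rewrite stieltjes_itvoc.
Qed.

End monotone_density.

Section primitive_of_absolutely_continuous.
Context {R : realType}.
Local Notation mu := (@lebesgue_measure R).
Implicit Types (f G : R -> R) (a b : R).

(** Projection onto the interval: it extends functions to the line by their
    values at the end points. *)
Let clamp a b t : R := Num.max a (Num.min t b).

Let clamp_id a b t : a <= t <= b -> clamp a b t = t.
Proof. by move=> /andP[at' tb]; rewrite /clamp (min_idPl tb) (max_idPr at'). Qed.

Let clamp_in a b t : a <= b -> a <= clamp a b t <= b.
Proof. by move=> ab; rewrite /clamp le_max lexx /= ge_max ab ge_min lexx orbT. Qed.

Let clamp_nd a b s t : s <= t -> clamp a b s <= clamp a b t.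
Proof. by move=> st; rewrite /clamp; apply: le_max2 => //; apply: le_min2. Qed.

Let clamp_lip a b s t : a <= b -> s <= t -> clamp a b t - clamp a b s <= t - s.
Proof.
move=> ab st; rewrite /clamp.
by case: (leP t b) => tb; case: (leP s b) => sb; rewrite /Num.max;
  (do !case: ifPn); rewrite -?leNgt; lra.
Qed.

Let nondecreasing_density a b G : a < b ->
  {in `[a, b] &, {homo G : s t / s <= t}} ->
  (forall e, 0 < e -> exists2 d, 0 < d & ac_modulus a b G e d) ->
  exists2 h : R -> R, mu.-integrable setT (EFin \o h) &
    forall t, a <= t <= b -> G t - G a = \int[mu]_(x in `]a, t]) h x.
Proof.
move=> ab ndG acG; have ab' := ltW ab; pose F t := G (clamp a b t).
have FE t : a <= t <= b -> F t = G t by move=> tab; rewrite /F clamp_id.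
have nd : nondecreasing F.
  by move=> s t st; apply: ndG; rewrite ?in_itv/= ?clamp_in//; exact: clamp_nd.
have rc : right_continuous F.
  move=> x; apply/(@cvgrPdist_le _ R^o) => e e0; have [d d0 H] := acG e e0.
  exists d => //= y xyd xy; rewrite distrC.
  have /andP[ax xb] := clamp_in x ab'; have /andP[ay yb] := clamp_in y ab'.
  have := H [:: (clamp a b x, clamp a b y)].
  rewrite !big_cons !big_nil !addr0 /=; apply.
    by rewrite /interval_family /= ax yb clamp_nd ?(ltW xy).
  apply: le_lt_trans (clamp_lip ab' (ltW xy)) _.
  by move: xyd; rewrite /ball_ /= distrC ger0_norm ?subr_ge0 ?(ltW xy).
pose Phi : cumulative R R := HB.pack F (isCumulative.Build R _ R F nd rc).
have PhiE t : a <= t <= b -> Phi t = G t := @FE t.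
have acPhi e : 0 < e -> exists2 d, 0 < d & ac_modulus a b Phi e d.
  move=> e0; have [d d0 H] := acG e e0; exists d => // s fs sd.
  have /andP[/allP al _] := fs.
  rewrite big_seq (eq_bigr (fun p => `|G p.2 - G p.1|)) -?big_seq ?H// => p /al.
  move=> /and3P[p1 p12 p2]; rewrite !PhiE//.
    by rewrite p1 (le_trans p12).
  by rewrite (le_trans p1).
have [h hint hE] := stieltjes_density ab acPhi.
by exists h => // t tab; rewrite -hE// !PhiE// lexx.
Qed.

(** The variation is at most e on intervals shorter than d, and finitely many of
    these cover the interval. *)
Let variation_fin a b f e d : 0 < d -> ac_modulus a b f e d -> a <= b ->
  total_variation a b f \is a fin_num.
Proof.
move=> d0 H ab.
have small x y : a <= x -> x <= y -> y <= b -> y - x < d ->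
    total_variation x y f \is a fin_num.
  move=> ax xy yb xyd; rewrite ge0_fin_numE ?total_variation_ge0//.
  apply: (@le_lt_trans _ _ e%:E); last by rewrite ltry.
  have := @total_variation_modulus _ a b f e d H [:: (x, y)] [::].
  rewrite !cats0 !big_cons !big_nil /= addr0 !adde0; apply => //.
  by rewrite /interval_family /= ax xy yb.
have chain n y : a <= y -> y <= b -> y - a <= n%:R * (d / 2) ->
    total_variation a y f \is a fin_num.
  elim: n y => [|n IH] y ay yb; first by move=> h; apply: small => //; lra.
  rewrite -natr1 mulrDl mul1r => h.
  have az : a <= Num.max a (y - d / 2) by rewrite le_max lexx.
  have zy : Num.max a (y - d / 2) <= y by rewrite ge_max ay; lra.
  have yz : y - d / 2 <= Num.max a (y - d / 2) by rewrite le_max lexx orbT.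
  have yzd : y - Num.max a (y - d / 2) < d by move: yz; set z := Num.max _ _ => yz; lra.
  rewrite (total_variationD f az zy) fin_numD (small _ _ az zy yb yzd) andbT.
  apply: IH => //; first exact: le_trans zy yb.
  have : 0 <= n%:R * (d / 2) by rewrite mulr_ge0// divr_ge0// ltW.
  move: h; set c := n%:R * (d / 2) => h c0.
  by rewrite /Num.max; case: ifP => _; lra.
apply: (chain (Num.truncn ((b - a) / (d / 2))).+1 b) => //.
by rewrite -ler_pdivrMr ?divr_gt0//; exact/ltW/truncnS_gt.
Qed.

Let neg_variation_density a b f : a < b ->
  (forall e, 0 < e -> exists2 d, 0 < d & ac_modulus a b f e d) ->
  exists2 h : R -> R, mu.-integrable setT (EFin \o h) &
    forall t, a <= t <= b -> fine (neg_tv a f t) - fine (neg_tv a f a) =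
                             \int[mu]_(x in `]a, t]) h x.
Proof.
move=> ab acf; have [d d0 Hd] := acf 1 ltr01; have ab' := ltW ab.
have bv : bounded_variation a b f.
  exact/(bounded_variationP _ ab')/(variation_fin d0 Hd ab').
apply: (@nondecreasing_density a b (fine \o neg_tv a f)) => //.
  exact: fine_neg_tv_nondecreasing.
have tv_fin x y : a <= x -> x <= y -> y <= b -> total_variation x y f \is a fin_num.
  move=> ax xy yb; apply/bounded_variationP => //.
  apply: (bounded_variationl xy yb).
  by apply: (bounded_variationr ax (le_trans xy yb)).
move=> e e0; have [d' d'0 H] := acf e e0; exists d' => // s fs sd.
have := @total_variation_modulus _ a b f e d' H s [::].
rewrite cats0 big_nil adde0 => /(_ fs sd); rewrite -lee_fin; apply: le_trans.
rewrite -sumEFin big_seq [leRHS]big_seq; apply: lee_sum => p ps.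
have /andP[/allP al _] := fs; have /and3P[p1 p12 p2] := al _ ps.
have v1 := tv_fin a p.1 (lexx _) p1 (le_trans p12 p2).
have v2 := tv_fin p.1 p.2 p1 p12 p2.
rewrite /= /neg_tv (total_variationD f p1 p12).
move: (total_variation_ge f p12) (total_variation_ge0 f p12).
rewrite -(fineK v1) -(fineK v2) -EFinD -!EFinB -!EFinM /= !lee_fin => tv1 tv0.
have -> : (fine (total_variation a p.1 f) + fine (total_variation p.1 p.2 f) - f p.2) / 2
   - (fine (total_variation a p.1 f) - f p.1) / 2 =
   (fine (total_variation p.1 p.2 f) - (f p.2 - f p.1)) / 2 by field.
move: tv1; rewrite !ler_norml => /andP[t1 t2]; apply/andP; split; lra.
Qed.

(** An absolutely continuous function is the difference of its two variations,
    which are monotone and again absolutely continuous, and the Stieltjes measure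
    of such a function has a density. *)
Lemma abs_continuous_primitive a b f : a < b -> abs_continuous a b f ->
  exists2 h : R -> R, mu.-integrable setT (EFin \o h) &
    forall t, a <= t <= b -> f t = f a + \int[mu]_(x in `]a, t]) h x.
Proof.
move=> ab acf; have ab' := ltW ab.
have acm e : 0 < e -> exists2 d, 0 < d & ac_modulus a b f e d.
  exact: abs_continuous_modulus.
have acmN e : 0 < e -> exists2 d, 0 < d & ac_modulus a b (\- f) e d.
  move=> /acm[d d0 H]; exists d => // s fs sd.
  rewrite (eq_bigr (fun p => `|f p.2 - f p.1|)) ?H// => p _ /=.
  by rewrite -opprD normrN.
have [h1 h1int h1E] := neg_variation_density ab acm.
have [h2 h2int h2E] := neg_variation_density ab acmN.
have [d d0 Hd] := acm 1 ltr01.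
have bv : bounded_variation a b f.
  exact/(bounded_variationP _ ab')/(variation_fin d0 Hd ab').
exists (fun x => h2 x - h1 x).
  by have := integrableB measurableT h2int h1int.
move=> t tab; rewrite RintegralB//.
- rewrite -h1E// -h2E//.
  rewrite (bounded_variation_pos_neg_tvE bv (x := t)) ?in_itv//=.
  by rewrite (bounded_variation_pos_neg_tvE bv (x := a)) ?in_itv/= ?lexx// /pos_tv; lra.
- by apply: integrableS h2int.
- by apply: integrableS h1int.
Qed.

End primitive_of_absolutely_continuous.

(** * Fractional integration by parts *)

Section absolutely_continuous_functions.
Context {R : realType}.
Local Notation mu := (@lebesgue_measure R).
Implicit Types (f g h : R -> R) (al a b t M : R).

(** The reflection of [energy_bounded_L1], which exchanges the two functions. *)
Lemma energy_L1_bounded al f g a b M : 0 < al ->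
  mu.-integrable setT (EFin \o f) -> measurable_fun setT g ->
  (forall u, `|g u| <= M) ->
  (forall t, b <= t -> f t = 0) -> (forall u, u <= a -> g u = 0) ->
  (\int[mu]_t \int[mu]_u `|(f t * (kpow al (t - u) * g u))%:E| < +oo)%E.
Proof.
move=> al0 fi mg gM fb ga; have mf := integrable_measurable fi.
have mN : measurable_fun setT (fun t : R => - t) by exact: oppr_measurable.
have mh : measurable_fun setT (fun z : R * R => f z.1 * (kpow al (z.1 - z.2) * g z.2)).
  apply: measurable_funM; first exact: (measurableT_comp mf).
  by apply: measurable_funM; [exact: measurable_kpowB|exact: (measurableT_comp mg)].
have mah : measurable_fun setT (fun z : R * R => `|(f z.1 * (kpow al (z.1 - z.2) * g z.2))%:E|%E).
  by apply: measurableT_comp => //; exact/measurable_EFinP.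
have Nb t : - a <= t -> g (- t) = 0 by move=> ta; apply: ga; rewrite lerNl.
have Na t : t <= - b -> f (- t) = 0 by move=> tb; apply: fb; rewrite lerNr.
have E := energy_bounded_L1 al0 (measurableT_comp mg mN) (integrable_opp fi)
  (fun u => gM (- u)) Nb Na.
suff -> : (\int[mu]_t \int[mu]_u `|(f t * (kpow al (t - u) * g u))%:E| =
    \int[mu]_u \int[mu]_t `|(g (- u) * (kpow al (u - t) * f (- t)))%:E|)%E by exact: E.
have abs0 (z : R * R) : (0 <= `|(f z.1 * (kpow al (z.1 - z.2) * g z.2))%:E|)%E.
  exact: abse_ge0.
rewrite (lebesgue_tonelli mah abs0).
pose H v := (\int[mu]_t `|(f t * (kpow al (t - v) * g v))%:E|)%E.
transitivity (\int[mu]_u H (- u)%R)%E.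
  rewrite (@ge0_integral_opp _ H)//; last by move=> v; apply: integral_ge0 => t _; exact: abse_ge0.
  apply: (@measurable_integral1 _ (fun z => `|(f z.2 * (kpow al (z.2 - z.1) * g z.1))%:E|%E)).
  exact: (measurableT_comp mah (@measurable_swap _ _ _ _)).
apply: eq_integral => u _ /=.
pose H' v := (`|(f v * (kpow al (v - - u) * g (- u)))%:E|)%E.
transitivity (\int[mu]_t H' (- t)%R)%E.
  rewrite (@ge0_integral_opp _ H')//; last by move=> v; exact: abse_ge0.
  apply: measurableT_comp => //; apply/measurable_EFinP; apply: (measurable_funM mf).
  by apply: measurable_funM => //; exact: measurable_kpowBl.
rewrite /H'; apply: eq_integral => t _ /=; congr (`|_|%:E); rewrite mulrCA mulrA mulrC.
by congr (_ * (kpow _ _ * _)); ring.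
Qed.

(** The density may be cut off outside of the interval, which makes the primitive
    a fractional integral of order 1 on the line. *)
Lemma abs_continuous_fracint1 a b f : a < b -> abs_continuous a b f ->
  exists h : R -> R, [/\ mu.-integrable setT (EFin \o h),
    forall t, t <= a -> h t = 0, forall t, b <= t -> h t = 0 &
    forall t, a <= t <= b -> f t = f a + fracint 1 h t].
Proof.
move=> ab acf; have [h ih hE] := abs_continuous_primitive ab acf.
have ih' : mu.-integrable setT (EFin \o (h \_ `]a, b[)).
  apply/(@integrable_restrictT _ [set` `]a, b[]); first exact: measurable_itv.
  exact: integrableS ih.
exists (h \_ `]a, b[); split => //.
- by move=> t; exact: restrict_itvoo_le.
- by move=> t; exact: restrict_itvoo_ge.
move=> t /andP[at' tb]; rewrite hE ?at'//; congr (_ + _).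
rewrite fracint1E; last exact: integrable_measurable.
have [->|tb'] := eqVneq t b; last first.
  rewrite Rintegral_mkcond [RHS]Rintegral_mkcond; apply: eq_Rintegral => u _.
  rewrite !restrictE !mem_setE !in_itv/=.
  case: (ltP a u) => au /=; last by case: ifP.
  by case: (leP u t) => //= ut; rewrite (le_lt_trans ut)// lt_neqAle tb'.
rewrite -(@Rintegral_itv_bndo_bndc _ (BRight a) b h); last by apply: integrableS ih.
rewrite Rintegral_mkcond [RHS]Rintegral_mkcond; apply: eq_Rintegral => u _.
rewrite !restrictE !mem_setE !in_itv/=.
case: (ltP a u) => au /=; last by case: ifP.
by case: (ltP u b) => ub /=; [rewrite (ltW ub)|case: ifP].
Qed.

End absolutely_continuous_functions.

Section integration_by_parts.
Context {R : realType}.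
Local Notation mu := (@lebesgue_measure R).
Let lam : {sigma_finite_measure set (measurableTypeR R) -> \bar R} := mu.
Implicit Types (f g h rho : R -> R) (al be a b t : R).

Lemma energy_lty al f g : measurable_fun setT f -> measurable_fun setT g ->
  (lam \x lam)%E.-integrable setT (fun z => (f z.1 * (kpow al (z.1 - z.2) * g z.2))%:E) ->
  (\int[mu]_t \int[mu]_u `|(f t * (kpow al (t - u) * g u))%:E| < +oo)%E.
Proof.
move=> mf mg ie.
have mh : measurable_fun setT
    (fun z : R * R => (f z.1 * (kpow al (z.1 - z.2) * g z.2))%:E).
  apply/measurable_EFinP; apply: measurable_funM; first exact: (measurableT_comp mf).
  by apply: measurable_funM; [exact: measurable_kpowB|exact: (measurableT_comp mg)].
exact: ((integrable12ltyP lam lam mh).1 ie).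
Qed.

Lemma frac_order1 al : 0 < al -> al < 1 -> frac_order al = 1%N.
Proof.
move=> al0 al1; rewrite /frac_order; congr _.+1; apply/eqP.
by rewrite -leqn0 -ltnS truncn_lt_nat// ltW.
Qed.

Lemma integrable_kpow_conv al be t u : 0 < al -> 0 < be ->
  mu.-integrable setT (fun s => (kpow al (t - s) * kpow be (s - u))%:E).
Proof.
move=> al0 be0; apply/integrableP; split.
  apply/measurable_EFinP; apply: measurable_funM; first exact: measurable_kpowBr.
  exact: measurable_kpowBl.
under eq_integral do rewrite gee0_abs ?lee_fin ?mulr_ge0 ?kpow_ge0//.
by rewrite kpow_conv_shift// ltry.
Qed.

(** The transpose of the primitive operator integrates from s up to the end t of
    the support. *)
Lemma fracint1_subE h s t : mu.-integrable setT (EFin \o h) -> s <= t ->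
  (forall u, t <= u -> h u = 0) ->
  \int[mu]_u (kpow 1 (u - s) * h u) = fracint 1 h t - fracint 1 h s.
Proof.
move=> ih st ht; have mh := integrable_measurable ih.
rewrite !fracint1E// (@Rintegral_itvB _ h -oo%O (BRight t) s)//; last first.
  by apply: integrableS ih.
rewrite [RHS]Rintegral_mkcond; apply: eq_Rintegral => u _.
rewrite restrictE mem_setE in_itv/=.
have [us|su] := leP u s; first by rewrite kpow_le0 ?subr_le0// mul0r.
rewrite /kpow subr_gt0 su subrr powRr0 mul1r /=.
by case: leP => // /ltW/ht.
Qed.

Section primitive.
Variables (a b : R) (f h : R -> R).
Hypothesis ab : a < b.
Hypothesis ih : mu.-integrable setT (EFin \o h).
Hypothesis ha : forall t, t <= a -> h t = 0.
Hypothesis hb : forall t, b <= t -> h t = 0.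
Hypothesis fE : forall t, a <= t <= b -> f t = f a + fracint 1 h t.

Let f0E t : (f \_ `]a, b[) t = ((fun s => f a + fracint 1 h s) \_ `]a, b[) t.
Proof.
rewrite !restrictE; case: ifP => //; rewrite mem_setE in_itv/= => /andP[at' tb].
by rewrite fE// (ltW at') (ltW tb).
Qed.

Lemma primitive_measurable : measurable_fun setT (f \_ `]a, b[).
Proof.
have -> : f \_ `]a, b[ = (fun s => f a + fracint 1 h s) \_ `]a, b[.
  by apply/funext => t; exact: f0E.
apply/(measurable_restrictT _ _).1 => //; apply: measurable_funTS.
by apply: measurable_funD => //; apply: measurable_fracint; exact: integrable_measurable.
Qed.

Lemma primitive_bounded : exists M, forall t, `|(f \_ `]a, b[) t| <= M.
Proof.
have cont : {within `[a, b]%classic, continuous (fun t => `|fracint 1 h t|)}.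
  apply: continuous_subspaceT => t.
  by apply: continuous_comp; [exact: continuous_fracint1|exact: norm_continuous].
have [c cab cmax] := EVT_max (ltW ab) cont.
exists (`|f a| + `|fracint 1 h c|) => t; rewrite f0E restrictE.
case: ifP => [|_]; last by rewrite normr0 addr_ge0.
rewrite mem_setE in_itv/= => /andP[at' tb].
apply: le_trans (ler_normD _ _) _; rewrite lerD2l.
by apply: cmax; rewrite in_itv/= (ltW at') (ltW tb).
Qed.

Lemma primitive_derive_ae : {ae mu, forall t, t \in `]a, b[ -> derive1 f t = h t}.
Proof.
apply: lebesgue_aeS (fracint1_derive_ae ih) => t [dt et] tab.
have := @eq_derive1n_itvoo _ 1 f (fun s => f a + fracint 1 h s) a b _ t tab.
rewrite !derive1n1 => ->.
  rewrite derive1E deriveD; [|exact: derivable_cst|exact: dt].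
  by rewrite derive_cst add0r -derive1E.
by move=> s; rewrite in_itv/= => /andP[as_ sb]; rewrite fE// (ltW as_) (ltW sb).
Qed.

Lemma Cder_right_primitive al t : 0 < al -> al < 1 -> a < t < b ->
  Cder_right al b f t = - RLint_right (1 - al) b h t.
Proof.
move=> al0 al1 /andP[at' tb]; rewrite /Cder_right /RLint_right frac_order1// expr1.
rewrite mulN1r mulNr; congr (- (_ * _)).
apply: (@ae_eq_Rintegral _ (measurableTypeR R) R lam).
- exact: measurable_itv.
- apply: measurable_funTS; apply: measurable_funM; last exact: integrable_measurable.
  by apply: (measurableT_comp (measurable_powR _)); exact: measurable_funB.
- apply: lebesgue_aeS primitive_derive_ae => u eu; rewrite /= in_itv/= => /andP[tu ub].
  rewrite -[X in _ * X = _]/(derive1 f u) (eu _); last by rewrite in_itv/= (lt_trans at' tu).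
  by congr (_ `^ _ * _); ring.
Qed.

(** The fractional derivative of order al of f: that of the constant f a, which
    is singular at a, plus the Caputo derivative. *)
Let rho al t := f a * ((Gamma (1 - al))^-1 * kpow (1 - al) (t - a)) + fracint (1 - al) h t.

Let integrable_rho al : 0 < al -> al < 1 ->
  mu.-integrable setT (EFin \o (rho al \_ `]a, b[)).
Proof.
move=> al0 al1; have be0 : 0 < 1 - al by rewrite subr_gt0.
have i1 := integrable_kpow_conv b a ltr01 be0.
have i2 := integrable_fracint b be0 ih ha.
have := integrableD measurableT
  (integrableZl measurableT (f a * (Gamma (1 - al))^-1) i1) i2.
apply: eq_integrable => // t _ /=; rewrite -EFinM -EFinD; congr EFin.
rewrite !restrictE !mem_setE !in_itv/=.
have [ta|at'] := leP t a.
  rewrite [kpow (1 - al) _]kpow_le0 ?subr_le0// (fracint_le _ ha ta).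
  by rewrite !mulr0 add0r; case: ifP.
have [bt|tb] := leP b t; first by rewrite kpow_le0 ?subr_le0// mul0r mulr0 addr0.
by rewrite {1}/kpow subr_gt0 tb subrr powRr0 mul1r /rho /= mulrA.
Qed.

Let RLint_rho al t : 0 < al -> al < 1 -> a < t -> t <= b ->
  RLint_left al a (rho al) t = f t.
Proof.
move=> al0 al1 at' tb; have be0 : 0 < 1 - al by rewrite subr_gt0.
have mh := integrable_measurable ih.
have alK : al + (1 - al) = 1 by rewrite addrC subrK.
have ik : mu.-integrable setT (fun u => (kpow (al + (1 - al)) (t - u) * h u)%:E).
  by rewrite alK; exact: integrable_kpow_ge1 ih ha.
have [i2 semi] := fracint_semigroup_integrable al0 be0 mh ik.
have i1 := integrable_kpow_conv t a al0 be0.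
rewrite (RLint_leftE _ _ _ tb).
set c := f a * (Gamma (1 - al))^-1.
have -> : fracint al (rho al \_ `]a, b[) t = (Gamma al)^-1 *
    \int[mu]_u (c * (kpow al (t - u) * kpow (1 - al) (u - a)) +
                kpow al (t - u) * fracint (1 - al) h u).
  congr (_ * _); apply: eq_Rintegral => u _.
  rewrite restrictE mem_setE in_itv/=.
  have [ua|au] := leP u a.
    rewrite mulr0 [kpow (1 - al) _]kpow_le0 ?subr_le0// (fracint_le _ ha ua).
    by rewrite !mulr0 addr0.
  have [bu|ub] /= := leP b u; last by rewrite /rho /c; ring.
  by rewrite kpow_le0 ?subr_le0 ?(le_trans tb)// !mul0r mulr0 addr0.
rewrite RintegralD//; last exact: (integrableZl measurableT c i1).
rewrite mulrDr -[X in _ + X]/(fracint al (fracint (1 - al) h) t) semi alK.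
rewrite RintegralZl//.
have -> : \int[mu]_u (kpow al (t - u) * kpow (1 - al) (u - a)) = Gamma al * Gamma (1 - al).
  rewrite /Rintegral kpow_conv_shift// alK Gamma1 divr1 /=.
  by rewrite /kpow subr_gt0 at' subrr powRr0 mulr1.
rewrite fE ?(ltW at')//; congr (_ + _); rewrite /c.
have := Gamma_gt0 al0; have := Gamma_gt0 be0.
by move: (Gamma al) (Gamma (1 - al)) => x y x0 y0; field; rewrite (gt_eqF x0) (gt_eqF y0).
Qed.

(** Both facts follow from f being the fractional integral of order al of rho:
    the first by inversion, the second by the semigroup law. *)
Lemma primitive_fractional al : 0 < al -> al < 1 -> exists rho : R -> R,
  [/\ mu.-integrable setT (EFin \o (rho \_ `]a, b[)),
      RLder_left al a f = rho %[ae mu in `]a, b[%classic] &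
      forall t, t <= b -> RLint_left (1 - al) a f t = fracint 1 (rho \_ `]a, b[) t].
Proof.
move=> al0 al1; have be0 : 0 < 1 - al by rewrite subr_gt0.
have ir := integrable_rho al0 al1; have mr := integrable_measurable ir.
exists (rho al); split => //.
  apply: RLder_left_RLint_left => //.
  apply: (lebesgue_aeS _ (aeW mu (fun x => erefl x))) => t _ /=.
  by rewrite in_itv/= => /andP[at' tb]; rewrite RLint_rho// ltW.
move=> t tb; rewrite (RLint_leftE _ _ _ tb).
have r0 u : u <= a -> (rho al \_ `]a, b[) u = 0 by exact: restrict_itvoo_le.
have alK : 1 - al + al = 1 by rewrite subrK.
have ik : mu.-integrable setT (fun u => (kpow (1 - al + al) (t - u) * (rho al \_ `]a, b[) u)%:E).
  by rewrite alK; exact: integrable_kpow_ge1 ir r0.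
have := fracint_semigroup be0 al0 mr ik; rewrite alK => <-.
congr (_ * _); apply: eq_Rintegral => u _.
have [tu|ut] := leP t u; first by rewrite kpow_le0 ?subr_le0// !mul0r.
congr (_ * _); have ub := lt_le_trans ut tb.
rewrite restrictE mem_setE in_itv/= ub andbT.
case: (ltP a u) => [au|ua]; last by rewrite (fracint_le _ r0 ua).
by rewrite -(RLint_leftE _ _ _ (ltW ub)) (RLint_rho al0 al1 au (ltW ub)).
Qed.

End primitive.

(** With densities h of f and k of g, the chain is: transpose I^(1 - al) from k to
    f, recognise the primitive of rho, transpose the primitive from rho to k, and
    recover g from k. *)
Lemma Caputo_right_by_parts al a b f g : a < b -> 0 < al -> al < 1 ->
  abs_continuous a b f -> abs_continuous a b g ->
  \int[mu]_(t in `]a, b[) (f t * Cder_right al b g t) =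
  \int[mu]_(t in `]a, b[) (g t * RLder_left al a f t) -
  (RLint_left (1 - al) a f b * g b - RLint_left (1 - al) a f a * g a).
Proof.
move=> ab al0 al1 acf acg; have be0 : 0 < 1 - al by rewrite subr_gt0.
have [h [ih ha hb fE]] := abs_continuous_fracint1 ab acf.
have [k [ik ka kb gE]] := abs_continuous_fracint1 ab acg.
have [rho [ir rE FE]] := primitive_fractional ih ha fE al0 al1.
have mk := integrable_measurable ik; have mr := integrable_measurable ir.
have mf := primitive_measurable ih fE; have mg := primitive_measurable ik gE.
have [M fM] := primitive_bounded ab ih fE.
have [N gN] := primitive_bounded ab ik gE.
pose f0 := f \_ `]a, b[; pose g0 := g \_ `]a, b[; pose r0 := rho \_ `]a, b[.
rewrite -/f0 in mf fM; rewrite -/g0 in mg gN; rewrite -/r0 in ir mr FE.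
have f0a u : u <= a -> f0 u = 0 by exact: restrict_itvoo_le.
have r0a u : u <= a -> r0 u = 0 by exact: restrict_itvoo_le.
have r0b u : b <= u -> r0 u = 0 by exact: restrict_itvoo_ge.
have [i1 i2 dual1] := Fubini_adjoint (measurable_kpowB (1 - al)) mk mf
  (energy_L1_bounded be0 ik mf fM kb f0a).
have [_ _ dual2] := Fubini_adjoint (measurable_kpowB 1) mk mr
  (energy_lty mk mr (energy_ge1 (lexx 1) ik ir kb r0a)).
have irg : mu.-integrable setT (fun u => (r0 u * g0 u)%:E).
  apply: (le_integrable measurableT _ _ (integrableZl measurableT N ir)).
    by apply/measurable_EFinP; exact: measurable_funM.
  move=> u _ /=; rewrite lee_fin !normrM mulrC.
  apply: ler_wpM2r; first exact: normr_ge0.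
  exact: le_trans (gN u) (ler_norm _).
have int_r0 : \int[mu]_u r0 u = fracint 1 r0 b.
  rewrite (fracint1E b mr) [RHS]Rintegral_mkcond; apply: eq_Rintegral => u _.
  rewrite restrictE mem_setE in_itv /=; have [ub|bu] := leP u b; first reflexivity.
  exact: r0b (ltW bu).
have Fa : RLint_left (1 - al) a f a = 0.
  by rewrite (FE a (ltW ab)); exact: fracint_le r0a (lexx a).
have Fb : RLint_left (1 - al) a f b = \int[mu]_u r0 u by rewrite int_r0; exact: FE (lexx b).
have in0 F u : u \in `]a, b[ -> (F \_ `]a, b[) u = F u :> R.
  by move=> uab; rewrite restrictE mem_setE uab.
have out0 F u : (u \in `]a, b[) = false -> (F \_ `]a, b[) u = 0 :> R.
  by move=> uab; rewrite restrictE mem_setE uab.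
rewrite Fa Fb mul0r subr0.
(* The derivative of g equals k only almost everywhere, but its integrals are
   those of k; the outer minus sign is that of the right derivative. *)
transitivity (- ((Gamma (1 - al))^-1 *
    \int[mu]_u (f0 u * \int[mu]_t (kpow (1 - al) (t - u) * k t)))).
  rewrite -(RintegralZl (Gamma (1 - al))^-1 measurableT i2) -RintegralN_nomeas Rintegral_mkcond.
  apply: eq_Rintegral => u _; have [uab|/negbTE uab] := boolP (u \in `]a, b[); last first.
    by rewrite (out0 _ _ uab) /f0 (out0 _ _ uab) mul0r mulr0 oppr0.
  have au : a <= u by move: uab; rewrite in_itv/= => /andP[/ltW].
  rewrite (in0 _ _ uab) /f0 (in0 _ _ uab) (Cder_right_primitive ik gE al0 al1).
    rewrite (RLint_rightE _ _ _ au) mulrN mulrCA; congr (- (_ * (_ * _))).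
    apply: eq_Rintegral => t _; congr (_ * _).
    have [tab|/negbTE tab] := boolP (t \in `]a, b[); first exact: in0.
    rewrite (out0 _ _ tab); move: tab; rewrite in_itv/=.
    by case: (ltP a t) => [_ /negbT|ta _]; [rewrite -leNgt => /kb|rewrite ka].
  by move: uab; rewrite in_itv.
rewrite -dual1.
transitivity (- \int[mu]_t (k t * \int[mu]_u (kpow 1 (t - u) * r0 u))).
  rewrite -(RintegralZl (Gamma (1 - al))^-1 measurableT i1); congr (- _); apply: eq_Rintegral => t _ /=.
  have [bt|tb] := leP b t; first by rewrite (kb _ bt) !mul0r mulr0.
  have := FE t (ltW tb); rewrite (RLint_leftE _ _ _ (ltW tb)) /fracint Gamma1 invr1 mul1r.
  by move=> <-; rewrite mulrCA.
rewrite dual2.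
transitivity (- \int[mu]_u (g b * r0 u - r0 u * g0 u)).
  congr (- _); apply: eq_Rintegral => u _ /=.
  have [uab|/negbTE uab] := boolP (u \in `]a, b[); last first.
    by rewrite /r0 (out0 _ _ uab) !mul0r mulr0 subr0.
  rewrite /g0 (in0 _ _ uab); move: uab; rewrite in_itv/= => /andP[au ub].
  have gb : g b = g a + fracint 1 k b by apply: gE; rewrite (ltW ab) lexx.
  have gu : g u = g a + fracint 1 k u by apply: gE; rewrite (ltW au) (ltW ub).
  rewrite (fracint1_subE ik (ltW ub) kb) gb gu.
  move: (r0 u) (g a) (fracint 1 k b) (fracint 1 k u) => w x y z; ring.
rewrite RintegralB; [|exact: measurableT|exact: (integrableZl measurableT (g b) ir)|exact: irg].
rewrite (RintegralZl (g b) measurableT ir) opprB [g b * _]mulrC; congr (_ - _).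
rewrite [RHS](@ae_eq_Rintegral _ (measurableTypeR R) R lam _ _ (fun t => r0 t * g0 t)).
- rewrite [RHS]Rintegral_mkcond; apply: eq_Rintegral => u _.
  have [uab|/negbTE uab] := boolP (u \in `]a, b[); first by rewrite (in0 _ _ uab).
  by rewrite (out0 _ _ uab) /r0 (out0 _ _ uab) mul0r.
- exact: measurable_itv.
- by apply: measurable_funTS; exact: measurable_funM.
- apply: lebesgue_aeS rE => t rt tab.
  by rewrite /r0 /g0 (in0 _ _ tab) (in0 _ _ tab) (rt tab) mulrC.
Qed.

End integration_by_parts.

Section both_sides.
Context {R : realType}.
Local Notation mu := (@lebesgue_measure R).
Let lam : {sigma_finite_measure set (measurableTypeR R) -> \bar R} := mu.
Implicit Types (f g phi psi F G : R -> R) (al p q a b t : R).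

(** The integrands are given up to null sets so that the statement applies both to
    integrals and, in [RLder_by_parts], to derivatives. *)
Lemma RLint_by_parts al p q a b f g F G : a < b -> 0 < al -> 1 <= p -> 1 <= q ->
  p^-1 + q^-1 <= 1 + al -> (p^-1 + q^-1 = 1 + al -> p != 1 /\ q != 1) ->
  in_Lp p a b f -> in_Lp q a b g ->
  F = (fun t => f t * RLint_left al a g t) %[ae mu in `]a, b[%classic] ->
  G = (fun t => g t * RLint_right al b f t) %[ae mu in `]a, b[%classic] ->
  \int[mu]_(t in `]a, b[) F t = \int[mu]_(t in `]a, b[) G t.
Proof.
move=> ab al0 p1 q1 pq pqc fp gq FE GE.
have mf := in_Lp_measurable fp; have mg := in_Lp_measurable gq.
have [i1 i2 dual] := Fubini_adjoint (measurable_kpowB al) mf mg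
  (energy_lty mf mg (energy_Lp al0 p1 q1 pq pqc fp gq)).
pose f0 := f \_ `]a, b[; pose g0 := g \_ `]a, b[.
rewrite -/f0 -/g0 in mf mg i1 i2 dual.
have in0 H u : u \in `]a, b[ -> (H \_ `]a, b[) u = H u :> R.
  by move=> uab; rewrite restrictE mem_setE uab.
have out0 H u : (u \in `]a, b[) = false -> (H \_ `]a, b[) u = 0 :> R.
  by move=> uab; rewrite restrictE mem_setE uab.
have cut (h H : R -> R) : measurable_fun setT H -> mu.-integrable setT (EFin \o H) ->
    h = (fun t => (Gamma al)^-1 * H t) %[ae mu in `]a, b[%classic] ->
    (forall t, (t \in `]a, b[) = false -> H t = 0) ->
    \int[mu]_(t in `]a, b[) h t = (Gamma al)^-1 * \int[mu]_t H t.
  move=> mH iH hE H0; rewrite -(RintegralZl (Gamma al)^-1 measurableT iH).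
  rewrite (@ae_eq_Rintegral _ (measurableTypeR R) R lam _ _ (fun t => (Gamma al)^-1 * H t)).
  - rewrite Rintegral_mkcond; apply: eq_Rintegral => t _.
    have [tab|/negbTE tab] := boolP (t \in `]a, b[); first exact: in0.
    by rewrite (out0 _ _ tab) (H0 _ tab) mulr0.
  - exact: measurable_itv.
  - by apply: measurable_funTS; exact: measurable_funM.
  - exact: hE.
rewrite (cut F _ (integrable_measurable i1) i1).
- rewrite dual (cut G _ (integrable_measurable i2) i2).
  + by [].
  + apply: lebesgue_aeS GE => t gt tab; rewrite (gt tab) /g0 (in0 _ _ tab).
    have at_ : a <= t by move: tab; rewrite /= in_itv/= => /andP[/ltW].
    by rewrite (RLint_rightE _ _ _ at_) mulrCA.
  + by move=> t tab; rewrite /g0 (out0 _ _ tab) mul0r.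
- apply: lebesgue_aeS FE => t ft tab; rewrite (ft tab) /f0 (in0 _ _ tab).
  have tb : t <= b by move: tab; rewrite /= in_itv/= => /andP[_ /ltW].
  by rewrite (RLint_leftE _ _ _ tb) mulrCA.
- by move=> t tab; rewrite /f0 (out0 _ _ tab) mul0r.
Qed.

(** The reflection of [RLder_left_RLint_left]. *)
Lemma RLder_right_RLint_right al a b phi f : 0 < al ->
  mu.-integrable setT (EFin \o (phi \_ `]a, b[)) ->
  f = RLint_right al b phi %[ae mu in `]a, b[%classic] ->
  RLder_right al b f = phi %[ae mu in `]a, b[%classic].
Proof.
move=> al0 iphi fE.
have flip t : (- t \in `](- b), (- a)[) = (t \in `]a, b[).
  by rewrite !in_itv/= !ltrN2 andbC.
have iphi' : mu.-integrable setT (EFin \o ((fun s => phi (- s)) \_ `](- b), (- a)[)).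
  apply: eq_integrable (integrable_opp iphi) => // t _ /=.
  by rewrite !restrictE !mem_setE -[t in RHS]opprK flip opprK.
have gE : (fun s => f (- s)) = RLint_left al (- b) (fun s => phi (- s))
    %[ae mu in `](- b), (- a)[%classic].
  apply: lebesgue_aeS (ae_reflect fE) => t ft /= tab.
  rewrite ft; first by rewrite RLint_right_opp opprK.
  by rewrite /= -flip opprK.
have := RLder_left_RLint_left al0 iphi' gE => /ae_reflect; apply: lebesgue_aeS => t dt tab.
by rewrite RLder_right_opp dt ?opprK//= flip.
Qed.

Lemma RLder_by_parts al p q a b f g : a < b -> 0 < al -> 1 <= p -> 1 <= q ->
  p^-1 + q^-1 <= 1 + al -> (p^-1 + q^-1 = 1 + al -> p != 1 /\ q != 1) ->
  in_RLint_right al p a b f -> in_RLint_left al q a b g ->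
  \int[mu]_(t in `]a, b[) (f t * RLder_left al a g t) =
  \int[mu]_(t in `]a, b[) (g t * RLder_right al b f t).
Proof.
move=> ab al0 p1 q1 pq pqc [phi phip fE] [psi psiq gE].
have df := RLder_right_RLint_right al0 (in_Lp_integrable p1 phip) fE.
have dg := RLder_left_RLint_left al0 (in_Lp_integrable q1 psiq) gE.
apply/esym; apply: (@RLint_by_parts al p q a b phi psi) => //.
- apply: lebesgue_aeS (lebesgue_aeI df gE) => t [dt gt] tab.
  by rewrite (dt tab) (gt tab) mulrC.
- apply: lebesgue_aeS (lebesgue_aeI dg fE) => t [dt ft] tab.
  by rewrite (dt tab) (ft tab) mulrC.
Qed.

Lemma abs_continuous_opp a b f : abs_continuous a b f ->
  abs_continuous (- b) (- a) (fun s => f (- s)).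
Proof.
move=> acf e /acf[d d0 H]; exists d => // n u v uv uvI uvd.
rewrite (eq_bigr (fun i => `|f (- u i) - f (- v i)|)); last by move=> i _; rewrite distrC.
apply: (H n (fun i => - v i) (fun i => - u i)).
- by move=> i; have [h1 [h2 h3]] := uv i; rewrite lerNr lerN2 lerNl.
- apply/trivIsetP => i j _ _ ij; have /trivIsetP/(_ i j I I ij) := uvI.
  rewrite -!subset0 => uvij x [/= xi xj]; apply: (uvij (- x)); split => /=.
    by move: xi; rewrite !in_itv/= ltrNr ltrNl andbC.
  by move: xj; rewrite !in_itv/= ltrNr ltrNl andbC.
- by rewrite (eq_bigr (fun i => v i - u i)) // => i _; rewrite opprK addrC.
Qed.

(** The reflection of [Caputo_right_by_parts]; it exchanges the end points, whence
    the opposite sign of the boundary terms. *)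
Lemma Caputo_left_by_parts al a b f g : a < b -> 0 < al -> al < 1 ->
  abs_continuous a b f -> abs_continuous a b g ->
  \int[mu]_(t in `]a, b[) (f t * Cder_left al a g t) =
  \int[mu]_(t in `]a, b[) (g t * RLder_right al b f t) +
  (RLint_right (1 - al) b f b * g b - RLint_right (1 - al) b f a * g a).
Proof.
move=> ab al0 al1 acf acg; have ab' : - b < - a by rewrite ltrN2.
have CE t : Cder_left al a g (- t) = Cder_right al (- a) (fun s => g (- s)) t.
  have -> : Cder_right al (- a) (fun s => g (- s)) t =
    Cder_left al (- - a) (fun s => g (- - s)) (- t) := Cder_right_opp _ _ _ _.
  have -> : (fun s => g (- - s)) = g by apply/funext => s; rewrite opprK.
  by rewrite [- - a]opprK.
rewrite (Rintegral_reflect_itvoo a b (fun t => f t * Cder_left al a g t)).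
transitivity (\int[mu]_(t in `](- b), (- a)[)
    (f (- t) * Cder_right al (- a) (fun s => g (- s)) t)).
  by apply: eq_Rintegral => t _; rewrite CE.
rewrite (Caputo_right_by_parts ab' al0 al1 (abs_continuous_opp acf) (abs_continuous_opp acg)).
congr (_ + _).
  rewrite (Rintegral_reflect_itvoo a b (fun t => g t * RLder_right al b f t)).
  by apply: eq_Rintegral => t _; rewrite RLder_right_opp opprK.
by rewrite !RLint_right_opp !opprK opprB.
Qed.

End both_sides.

(** * Expectations of path integrals and the theorem *)

Section expectation_of_path_integrals.
Context {d : measure_display} {T : measurableType d} {R : realType}.
Variable P : probability T R.
Local Notation mu := (@lebesgue_measure R).
Let lam : {sigma_finite_measure set (measurableTypeR R) -> \bar R} := mu.
Implicit Types (X Y : R -> T -> R) (phi : R -> R) (a b t c : R).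

Lemma mean_scale c (U : T -> R) : U \in Lfun P 2%:E ->
  (\int[P]_w (U w * c)%:E = (fine 'E_P[U] * c)%:E)%E.
Proof.
move=> U2; have U1 : U \in Lfun P 1 by exact: (Lfun_subset12 (fin_num_measure P _ measurableT)) U2.
have iU := (Lfun1_integrable _ _).1 U1.
rewrite EFinM fineK ?expectation_fin_num// unlock -integralZr//.
Qed.

(** Fubini on the product of the probability space and the interval: for almost
    every path the integral is finite, and the inner expectation is the mean times
    the deterministic factor. *)
Lemma Eint_mean a b X phi : (forall t, a < t < b -> X t \in Lfun P 2%:E) ->
  path_integrable P a b (fun t w => X t w * phi t) ->
  Eint P a b (fun t w => X t w * phi t) =
  (\int[mu]_(t in `]a, b[) (mean P X t * phi t))%:E.
Proof.
move=> X2; rewrite /path_integrable => iZ.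
(* The integrand is extended by 0 to all times, as Fubini is available on full
   products. *)
pose D : set (T * measurableTypeR R) := [set: T] `*` `]a, b[%classic.
have mD : measurable D by apply: measurableX => //; exact: measurable_itv.
pose h : T * measurableTypeR R -> \bar R := (fun z => (X z.2 z.1 * phi z.2)%:E) \_ D.
have ih : (P \x lam)%E.-integrable setT h by exact: (integrable_mkcond _ mD).1 iZ.
have hE w t : h (w, t) = ((fun s => (X s w * phi s)%:E) \_ `]a, b[) t.
  rewrite /h !erestrictE /=; congr (if _ then _ else _).
  by rewrite /D; apply/idP/idP; rewrite !inE /=; [case|split].
have ae_path : {ae P, forall w, (path_int a b (fun t w => X t w * phi t) w)%:E =
    (\int[lam]_t h (w, t))%E}.
  apply: filterS (ae_integrable1 ih) => w iw.
  have -> : (\int[lam]_t h (w, t) = \int[lam]_(t in `]a, b[) (X t w * phi t)%:E)%E.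
    by rewrite [RHS]integral_mkcond; apply: eq_integral => t _; rewrite hE.
  rewrite /path_int /Rintegral fineK//.
  have := integrable_fin_num measurableT iw.
  suff -> : (\int[lam]_t h (w, t) = \int[lam]_(t in `]a, b[) (X t w * phi t)%:E)%E by [].
  by rewrite [RHS]integral_mkcond; apply: eq_integral => t _; rewrite hE.
have iF := integrable_fubini_F ih.
transitivity (\int[P]_w \int[lam]_t h (w, t))%E.
  rewrite /Eint unlock; apply: ae_eq_integral_nomeas => //.
    exact: measurable_int iF.
  by apply: filterS ae_path => w + _.
have Ffin := integrable_fin_num measurableT iF.
have E2 : (\int[P]_w \int[lam]_t h (w, t) =
    \int[lam]_(t in `]a, b[) (mean P X t * phi t)%:E)%E.
  rewrite (Fubini ih) [RHS]integral_mkcond; apply: eq_integral => t _.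
  under eq_integral do rewrite hE.
  rewrite erestrictE; case: ifPn => [|tab].
    rewrite mem_setE in_itv/= => tab.
    transitivity (\int[P]_w (X t w * phi t)%:E)%E; last by rewrite mean_scale// X2.
    by apply: eq_integral => w _; rewrite erestrictE mem_setE in_itv/= tab.
  by rewrite integral0_eq// => w _; rewrite erestrictE (negbTE tab).
rewrite E2 /Rintegral fineK//; move: Ffin; rewrite /fubini_F.
by rewrite E2.
Qed.

Lemma Ebracket_mean a b (phi : R -> R) Y :
  Y a \in Lfun P 2%:E -> Y b \in Lfun P 2%:E ->
  Ebracket P a b (fun t w => phi t * Y t w) =
  (phi b * mean P Y b - phi a * mean P Y a)%:E.
Proof.
move=> Ya Yb; rewrite /Ebracket unlock EFinB.
by congr (_ - _)%E; under eq_integral do rewrite mulrC; rewrite mean_scale// mulrC.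
Qed.

End expectation_of_path_integrals.

Theorem lemma1 (R : realType) (d : measure_display) (T : measurableType d)
    (P : probability T R) (I : set R) (a b : R) (X Y : R -> T -> R)
    (alpha p q : R)
    (I_open : open I) (I_itv : is_interval I)
    (ab : a < b) (abI : `[a, b] `<=` I)
    (X2 : second_order P I X) (Y2 : second_order P I Y)
    (alpha0 : 0 < alpha) (p1 : 1 <= p) (q1 : 1 <= q)
    (pq : p^-1 + q^-1 <= 1 + alpha)
    (pq_crit : p^-1 + q^-1 = 1 + alpha -> p != 1 /\ q != 1) :
  [/\ (* (i) *)
      in_Lp p a b (mean P X) -> in_Lp q a b (mean P Y) ->
      path_integrable P a b (fun t w => X t w * sRLint_left P alpha a Y t) ->
      path_integrable P a b (fun t w => Y t w * sRLint_right P alpha b X t) ->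
      Eint P a b (fun t w => X t w * sRLint_left P alpha a Y t) =
      Eint P a b (fun t w => Y t w * sRLint_right P alpha b X t),
      (* (ii) *)
      in_RLint_right alpha p a b (mean P X) ->
      in_RLint_left alpha q a b (mean P Y) ->
      path_integrable P a b (fun t w => X t w * sRLder_left P alpha a Y t) ->
      path_integrable P a b (fun t w => Y t w * sRLder_right P alpha b X t) ->
      Eint P a b (fun t w => X t w * sRLder_left P alpha a Y t) =
      Eint P a b (fun t w => Y t w * sRLder_right P alpha b X t)
    & (* (iii) *)
      alpha < 1 ->
      abs_continuous a b (mean P X) -> abs_continuous a b (mean P Y) ->
      (path_integrable P a b (fun t w => X t w * sCder_left P alpha a Y t) ->
       path_integrable P a b (fun t w => Y t w * sRLder_right P alpha b X t) ->
       Eint P a b (fun t w => X t w * sCder_left P alpha a Y t) =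
       (Eint P a b (fun t w => Y t w * sRLder_right P alpha b X t)%R +
        Ebracket P a b (fun t w => sRLint_right P (1 - alpha) b X t * Y t w)%R)%E)
      /\
      (path_integrable P a b (fun t w => X t w * sCder_right P alpha b Y t) ->
       path_integrable P a b (fun t w => Y t w * sRLder_left P alpha a X t) ->
       Eint P a b (fun t w => X t w * sCder_right P alpha b Y t) =
       (Eint P a b (fun t w => Y t w * sRLder_left P alpha a X t)%R -
        Ebracket P a b (fun t w => sRLint_left P (1 - alpha) a X t * Y t w)%R)%E)].
Proof.
have abI' t : a <= t <= b -> I t by move=> tab; apply: abI; rewrite /= in_itv.
have Xt t : a < t < b -> X t \in Lfun P 2%:E.
  by move=> /andP[at' tb]; apply/X2/abI'; rewrite (ltW at') (ltW tb).
have Yt t : a < t < b -> Y t \in Lfun P 2%:E.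
  by move=> /andP[at' tb]; apply/Y2/abI'; rewrite (ltW at') (ltW tb).
have Ya : Y a \in Lfun P 2%:E by apply/Y2/abI'; rewrite lexx (ltW ab).
have Yb : Y b \in Lfun P 2%:E by apply/Y2/abI'; rewrite lexx (ltW ab).
split.
- move=> Xp Yq iX iY; rewrite (Eint_mean Xt iX) (Eint_mean Yt iY); congr EFin.
  exact: (RLint_by_parts ab alpha0 p1 q1 pq pq_crit Xp Yq (aeW _ (fun _ _ => erefl)) (aeW _ (fun _ _ => erefl))).
- move=> Xp Yq iX iY; rewrite (Eint_mean Xt iX) (Eint_mean Yt iY); congr EFin.
  exact: (RLder_by_parts ab alpha0 p1 q1 pq pq_crit Xp Yq).
- move=> alpha1 acX acY; split=> iX iY; rewrite (Eint_mean Xt iX) (Eint_mean Yt iY).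
    rewrite (Ebracket_mean (sRLint_right P (1 - alpha) b X) Ya Yb) -EFinD; congr EFin.
    exact: Caputo_left_by_parts.
  rewrite (Ebracket_mean (sRLint_left P (1 - alpha) a X) Ya Yb) -EFinB; congr EFin.
  exact: Caputo_right_by_parts.
Qed.
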